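(* Consider problem (OC) in which the system is the linear system $\dot x=\mathrm{diag}(a_1,\dots,a_n)\,x+1_{n\times1}u$ (i.e. $f(x)=\mathrm{diag}(a_1,\dots,a_n)x$ and $g\equiv 1_{n\times 1}$, with $a_1,\dots,a_n\in\mathbb{R}$), with an optimal trajectory $(x^\star,u^\star)$ and multipliers as in hypothesis (P). Suppose Assumptions 1, 4(a) and 5 hold, and suppose: (a) there exist $j_1,j_2\in\{1,\dots,n\}$ with $\lambda_{j_1}(t_f^-)>\lambda_{j_2}(t_f^-)$ and $a_{j_1}>a_{j_2}$; (b) for all $k,j\in\{1,\dots,n\}$, $\lambda_k(t_f^-)\ge\lambda_j(t_f^-)$ implies $a_k\ge a_j$; (c) for every index $i$ such that $\bar s_i$ is active on some time interval of positive length, for a.e. $t$ in the set of times at which $\bar s_i$ is active: (i) $\partial\bar s_i^\star[t]/\partial u>0$, and (ii) for all $k,j\in\{1,\dots,n\}$, $\lambda_k(t_f^-)\ge\lambda_j(t_f^-)$ implies $p^\star_{i,k}[t]\le p^\star_{i,j}[t]$. Then $\lambda(t)^\top g^\star[t]>0$ and $u^\star(t)=\max\mathcal D(x^\star(t))$ for a.e. $t\in[0,t_f]$, and the optimal trajectory is bang-ride.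
   Context: Setting. Fix $n\ge1$. System: $\dot x(t)=F(x(t),u(t)):=f(x(t))+g(x(t))u(t)$ with $f,g:\mathbb{R}^n\to\mathbb{R}^n$, state $x(t)\in\mathbb{R}^n$, scalar input $u(t)\in\mathbb{R}$. Admissible inputs are piecewise continuous $u:[0,t_f]\to\mathbb{R}$ with finitely many discontinuities, continuous at $0$ and $t_f$, and equal to their left limit at each discontinuity in $(0,t_f)$. Problem (OC): minimize $\phi(x(t_f))+\int_0^{t_f} l(x(t))\,dt$ over admissible $u$ (and over $t_f$ when the terminal time is free) subject to the dynamics, $x(0)=x_0$, $s(x(t),u(t))\le 0$ and $h(x(t))\le 0$ for all $t\in[0,t_f]$, and $z(x(t_f))\ge 0$, where $l,\phi:\mathbb{R}^n\to\mathbb{R}$, $s:\mathbb{R}^n\times\mathbb{R}\to\mathbb{R}^{c_s}$ (mixed constraints, among whose components are the input bounds $u_{\min}-u\le0$ and $u-u_{\max}\le 0$), $h:\mathbb{R}^n\to\mathbb{R}^{c_h}$ (state constraints), $z:\mathbb{R}^n\to\mathbb{R}^{c_z}$; vector inequalities are componentwise. $(x^\star,u^\star)$ denotes an optimal trajectory; for a function $q(x,u)$ write $q^\star[t]:=q(x^\star(t),u^\star(t))$, and $q_x,q_u$ for its partial derivatives (Jacobians). Let $\dot h(x,u):=J_h(x)F(x,u)$ with $J_h$ the Jacobian of $h$, and set $\bar s_i:=s_i$ for $1\le i\le c_s$ and $\bar s_i:=\dot h_{i-c_s}$ for $c_s<i\le c_s+c_h$. A mixed constraint $s_i$ is active at $t$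 if $s_i^\star[t]=0$; a state constraint $h_i$ is active at $t$ if $h_i(x^\star(t))=0$; $\bar s_i$ is called active at $t$ iff $s_i$ (for $i\le c_s$), resp. $h_{i-c_s}$ (for $i>c_s$), is active at $t$. The state-dependent control set is $\mathcal D(x):=\{u\in\mathbb{R}: s(x,u)\le 0,\ \dot h_i(x,u)\le 0 \text{ for every } i \text{ with } h_i(x)=0\}$. The optimal trajectory is called bang-ride if for a.e. $t\in[0,t_f]$ at least one constraint (some $s_i$ or some $h_i$) is active at $t$. The relative sensitivity of $\bar s_i$ with respect to $x_j$ is $p_{i,j}(x,u):=\big[\partial\bar s_i(x,u)/\partial u\big]^{-1}\,\partial\bar s_i(x,u)/\partial x_j$, and $p^\star_{i,j}[t]:=p_{i,j}(x^\star(t),u^\star(t))$. An entry time is a time $\tau$ such that some $h_i$ is inactive on a nonempty open interval ending at $\tau$ and active on an interval $[\tau,\tau+\epsilon)$, $\epsilon>0$; it is assumed there are no contact times (instants at which a state constraint is active but inactive immediately before and after). Assumption 1 (standard regularity): (a) $f,g,\phi,s,l,z$ are continuously differentiable and each component of $h$ is $C^2$; (b) for a.e. $t\in[0,t_f]$ the matrix $\begin{bmatrix} s^\star_u[t] & \mathrm{diag}(s^\star[t]) & 0\\ \dot h^\star_u[t] & 0 & \mathrm{diag}(h(x^\star(t)))\end{bmatrix}$ has rank $c_s+c_h$. Assumption 4(a): $t_f$ is free or fixed, $l\equiv 0$, and $\mathrm{rank}\begin{bmatrix}\phi_x & 0\\ z_x & \mathrm{diag}(z)\end{bmatrix}\Big|_{x^\star(t_f)}=c_z+1$.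 Assumption 5 (switching of state constraints): Define $\mathcal G^\star(t):=\{i: h_i(x^\star(t))=0\}$, $\mathcal G^\star(t^+):=\{i:\text{there exist } k>t \text{ arbitrarily close to } t \text{ with } h_i(x^\star(k))=0\}$, $\mathcal G^\star(t^-):=\{i:\text{there exist } k<t \text{ arbitrarily close to } t \text{ with } h_i(x^\star(k))=0\}$. Assumption 5 requires: (a) $\mathcal G^\star(0)=\mathcal G^\star(0^+)$ and $\mathcal G^\star(t_f)=\mathcal G^\star(t_f^-)$; (b) at each entry time $\tau\in(0,t_f)$, $u^\star$ is discontinuous at $\tau$. (Vacuous if there are no state constraints.) Hypothesis (P) (Pontryagin necessary conditions, taken as given): there exist a constant $\lambda_0\le 0$, a piecewise absolutely continuous $\lambda:[0,t_f]\to\mathbb{R}^n$ (the costate), piecewise continuous $\mu:[0,t_f]\to\mathbb{R}^{c_s}$ and $\nu:[0,t_f]\to\mathbb{R}^{c_h}$, vectors $\alpha\in\mathbb{R}^{c_z}$, $\gamma\in\mathbb{R}^{c_h}$, and a vector $\eta(\tau_i)\in\mathbb{R}^{c_h}$ for each discontinuity time $\tau_i$ of $\lambda$, such that, with Hamiltonian $H(x,u,\lambda_0,\lambda)=\lambda_0 l(x)+\lambda^\top F(x,u)$ and Lagrangian $L=H+\mu^\top s+\nu^\top \dot h$: (i) for every $t$, $(\lambda_0,\lambda(t),\mu(t),\nu(t),\alpha,\gamma,\eta(\tau_1),\eta(\tau_2),\dots)\neq 0$; (ii) for a.e. $t$: $H(x^\star(t),u^\star(t),\lambda_0,\lambda(t))=\max_{u\in\mathcal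 D(x^\star(t))}H(x^\star(t),u,\lambda_0,\lambda(t))$; $\lambda(t)^\top g^\star[t]+\mu(t)^\top s^\star_u[t]+\nu(t)^\top\dot h^\star_u[t]=0$; $\dot\lambda(t)^\top=-\lambda_0 l_x(x^\star(t))-\lambda(t)^\top F_x^\star[t]-\mu(t)^\top s^\star_x[t]-\nu(t)^\top\dot h^\star_x[t]$; $\mu(t)\le 0$, $\mu(t)^\top s^\star[t]=0$; $\nu(t)\le0$, $\nu(t)^\top h(x^\star(t))=0$; (iii) $\lambda(t_f^-)^\top=\lambda_0\phi_x(x^\star(t_f))+\alpha^\top z_x(x^\star(t_f))+\gamma^\top h_x(x^\star(t_f))$, $\alpha\ge0$, $\gamma\le 0$, $\alpha^\top z(x^\star(t_f))=\gamma^\top h(x^\star(t_f))=0$; (iv) $\lambda$ can be discontinuous only at entry times $\tau_i$, where $\lambda(\tau_i^-)^\top=\lambda(\tau_i^+)^\top+\eta(\tau_i)^\top h_x(x^\star(\tau_i))$, $\eta(\tau_i)\le 0$, $\eta(\tau_i)^\top h(x^\star(\tau_i))=0$; (v) if $t_f$ is free, $H(x^\star(t),u^\star(t),\lambda_0,\lambda(t))=0$ for all $t\in[0,t_f]$. Fact (F), taken as part of the necessary-condition theory: under Assumption 5, $\lambda$ is continuous on $[0,t_f]$ (in particular $\lambda(t_f^-)=\lambda(t_f)$), all jump vectors $\eta(\tau_i)$ vanish, and $\gamma=0$. *)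

(* Defs.v *)
From HB Require Import structures.
From mathcomp Require Import all_boot all_order all_algebra.
From mathcomp Require Import all_classical all_reals all_analysis.
Set Implicit Arguments. Unset Strict Implicit. Unset Printing Implicit Defensive.
Import Order.TTheory GRing.Theory Num.Theory.
Import numFieldNormedType.Exports.
Local Open Scope classical_set_scope.
Local Open Scope ring_scope.

Definition pd {R : realType} {n : nat} (phi : 'rV[R]_n -> R) (j : 'I_n)
  (x : 'rV[R]_n) : R := 'D_(delta_mx 0 j) phi x.

Definition du {R : realType} (psi : R -> R) (u : R) : R := 'D_1 psi u.

Definition grad {R : realType} {n : nat} (phi : 'rV[R]_n -> R) (x : 'rV[R]_n)
  : 'rV[R]_n := \row_j pd phi j x.

Definition C1x {R : realType} {n : nat} (phi : 'rV[R]_n -> R) : Prop :=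
  forall j : 'I_n, (forall x, derivable phi x (delta_mx 0 j)) /\
                   continuous (pd phi j).

Definition C2x {R : realType} {n : nat} (phi : 'rV[R]_n -> R) : Prop :=
  C1x phi /\ forall j : 'I_n, C1x (pd phi j).

Definition C1xu {R : realType} {n : nat} (q : 'rV[R]_n -> R -> R) : Prop :=
  (forall (j : 'I_n) x u, derivable (fun y => q y u) x (delta_mx 0 j)) /\
  (forall x u, derivable (q x) u 1) /\
  (forall j : 'I_n,
     continuous (fun p : 'rV[R]_n * R => pd (fun y => q y p.2) j p.1)) /\
  continuous (fun p : 'rV[R]_n * R => du (q p.1) p.2).

Definition ae_on {R : realType} (A : set R) (P : R -> Prop) : Prop :=
  {ae (@lebesgue_measure R), forall t, A t -> P t}.

Definition abs_cont {R : realType} (a b : R) (w : R -> R) : Prop :=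
  forall e : R, 0 < e -> exists d : R, 0 < d /\
    forall (m : nat) (lo hi : 'I_m -> R),
      (forall k, a <= lo k /\ lo k <= hi k /\ hi k <= b) ->
      (forall k l : 'I_m, (k < l)%N -> hi k <= lo l) ->
      \sum_(k < m) (hi k - lo k) < d ->
      \sum_(k < m) `|w (hi k) - w (lo k)| < e.

Definition pw_abs_cont {R : realType} {n : nat} (tf : R) (w : R -> 'rV[R]_n)
  : Prop :=
  exists (K : nat) (tp : nat -> R),
    tp 0%N = 0 /\ tp K = tf /\ (forall k, (k < K)%N -> tp k < tp k.+1) /\
    forall k, (k < K)%N -> exists wk : R -> 'rV[R]_n,
      (forall t, tp k < t < tp k.+1 -> wk t = w t) /\
      forall j : 'I_n, abs_cont (tp k) (tp k.+1) (fun t => wk t 0 j).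

Definition pw_cont {R : realType} {V : normedModType R} (tf : R) (w : R -> V)
  : Prop :=
  exists D : seq R,
    (forall d, d \in D -> 0 <= d <= tf) /\
    (forall t, 0 <= t <= tf -> t \notin D ->
       (w @ within `[0, tf] (nbhs t)) --> w t) /\
    (forall d, d \in D -> 0 < d -> exists l : V, w x @[x --> d^'-] --> l) /\
    (forall d, d \in D -> d < tf -> exists l : V, w x @[x --> d^'+] --> l).

Definition admissible {R : realType} (tf : R) (u : R -> R) : Prop :=
  exists D : seq R,
    (forall d, d \in D -> 0 < d < tf) /\
    (forall t, 0 <= t <= tf -> t \notin D ->
       (u @ within `[0, tf] (nbhs t)) --> u t) /\
    (forall d, d \in D -> u x @[x --> d^'-] --> u d) /\
    (forall d, d \in D -> exists l : R, u x @[x --> d^'+] --> l).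

Definition Fsys {R : realType} {n : nat} (f g : 'rV[R]_n -> 'rV[R]_n)
  (x : 'rV[R]_n) (u : R) : 'rV[R]_n := f x + u *: g x.

Definition fdiag {R : realType} {n : nat} (a : 'I_n -> R) (x : 'rV[R]_n)
  : 'rV[R]_n := \row_k (a k * x 0 k).

Definition gone {R : realType} {n : nat} (x : 'rV[R]_n) : 'rV[R]_n :=
  const_mx 1.

Definition hdot {R : realType} {n : nat} (F : 'rV[R]_n -> R -> 'rV[R]_n)
  (h : 'rV[R]_n -> R) (x : 'rV[R]_n) (u : R) : R :=
  \sum_(j < n) pd h j x * F x u 0 j.

Definition sbar {R : realType} {n cs ch : nat} (F : 'rV[R]_n -> R -> 'rV[R]_n)
  (s : 'I_cs -> 'rV[R]_n -> R -> R) (h : 'I_ch -> 'rV[R]_n -> R)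
  (i : 'I_(cs + ch)) : 'rV[R]_n -> R -> R :=
  match fintype.split i with inl k => s k | inr k => hdot F (h k) end.

(* value of the constraint whose activity defines activity of \bar s_i :
   s_i itself for i <= c_s, h_{i-c_s} for i > c_s *)
Definition cval {R : realType} {n cs ch : nat}
  (s : 'I_cs -> 'rV[R]_n -> R -> R) (h : 'I_ch -> 'rV[R]_n -> R)
  (i : 'I_(cs + ch)) (x : 'rV[R]_n) (u : R) : R :=
  match fintype.split i with inl k => s k x u | inr k => h k x end.

Definition psens {R : realType} {n cs ch : nat} (F : 'rV[R]_n -> R -> 'rV[R]_n)
  (s : 'I_cs -> 'rV[R]_n -> R -> R) (h : 'I_ch -> 'rV[R]_n -> R)
  (i : 'I_(cs + ch)) (j : 'I_n) (x : 'rV[R]_n) (u : R) : R :=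
  (du (sbar F s h i x) u)^-1 * pd (fun y => sbar F s h i y u) j x.

Definition Dset {R : realType} {n cs ch : nat} (F : 'rV[R]_n -> R -> 'rV[R]_n)
  (s : 'I_cs -> 'rV[R]_n -> R -> R) (h : 'I_ch -> 'rV[R]_n -> R)
  (x : 'rV[R]_n) : set R :=
  [set u | (forall i, s i x u <= 0) /\
           (forall i, h i x = 0 -> hdot F (h i) x u <= 0)].

Definition Ham {R : realType} {n : nat} (F : 'rV[R]_n -> R -> 'rV[R]_n)
  (l : 'rV[R]_n -> R) (x : 'rV[R]_n) (u l0 : R) (lam : 'rV[R]_n) : R :=
  l0 * l x + \sum_(k < n) lam 0 k * F x u 0 k.

Definition solves {R : realType} {n : nat} (F : 'rV[R]_n -> R -> 'rV[R]_n)
  (tf : R) (x0 : 'rV[R]_n) (x : R -> 'rV[R]_n) (u : R -> R) : Prop :=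
  x 0 = x0 /\ {within `[0, tf], continuous x} /\
  exists E : seq R, forall t, 0 < t < tf -> t \notin E ->
    is_derive t (1 : R) x (F (x t) (u t)).

Definition feasible {R : realType} {n cs ch cz : nat}
  (F : 'rV[R]_n -> R -> 'rV[R]_n)
  (s : 'I_cs -> 'rV[R]_n -> R -> R) (h : 'I_ch -> 'rV[R]_n -> R)
  (z : 'I_cz -> 'rV[R]_n -> R) (x0 : 'rV[R]_n)
  (tf : R) (x : R -> 'rV[R]_n) (u : R -> R) : Prop :=
  0 < tf /\ admissible tf u /\ solves F tf x0 x u /\
  (forall t, 0 <= t <= tf ->
     (forall i, s i (x t) (u t) <= 0) /\ (forall i, h i (x t) <= 0)) /\
  (forall i, 0 <= z i (x tf)).

Definition cost {R : realType} {n : nat} (phi l : 'rV[R]_n -> R)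
  (tf : R) (x : R -> 'rV[R]_n) : R :=
  phi (x tf) + Rintegral (@lebesgue_measure R) `[0, tf] (fun t => l (x t)).

Definition optimal {R : realType} {n cs ch cz : nat}
  (F : 'rV[R]_n -> R -> 'rV[R]_n)
  (s : 'I_cs -> 'rV[R]_n -> R -> R) (h : 'I_ch -> 'rV[R]_n -> R)
  (z : 'I_cz -> 'rV[R]_n -> R) (phi l : 'rV[R]_n -> R) (tf_free : bool)
  (x0 : 'rV[R]_n) (tf : R) (xs : R -> 'rV[R]_n) (us : R -> R) : Prop :=
  feasible F s h z x0 tf xs us /\
  forall (tf' : R) (x : R -> 'rV[R]_n) (u : R -> R),
    (tf_free \/ tf' = tf) -> feasible F s h z x0 tf' x u ->
    cost phi l tf xs <= cost phi l tf' x.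

Definition entry_time {R : realType} {n ch : nat} (h : 'I_ch -> 'rV[R]_n -> R)
  (xs : R -> 'rV[R]_n) (tau : R) : Prop :=
  exists i : 'I_ch,
    (exists a, a < tau /\ forall t, a < t < tau -> h i (xs t) <> 0) /\
    (exists eps, 0 < eps /\ forall t, tau <= t < tau + eps -> h i (xs t) = 0).

Definition contact_time {R : realType} {n ch : nat} (h : 'I_ch -> 'rV[R]_n -> R)
  (xs : R -> 'rV[R]_n) (t : R) : Prop :=
  exists i : 'I_ch, h i (xs t) = 0 /\
    exists eps, 0 < eps /\
      forall t', 0 < `|t' - t| < eps -> h i (xs t') <> 0.

Definition Gplus {R : realType} {n ch : nat} (h : 'I_ch -> 'rV[R]_n -> R)
  (xs : R -> 'rV[R]_n) (t : R) (i : 'I_ch) : Prop :=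
  forall eps, 0 < eps -> exists k, t < k < t + eps /\ h i (xs k) = 0.
Definition Gminus {R : realType} {n ch : nat} (h : 'I_ch -> 'rV[R]_n -> R)
  (xs : R -> 'rV[R]_n) (t : R) (i : 'I_ch) : Prop :=
  forall eps, 0 < eps -> exists k, t - eps < k < t /\ h i (xs k) = 0.

Definition assumption5 {R : realType} {n ch : nat} (h : 'I_ch -> 'rV[R]_n -> R)
  (tf : R) (xs : R -> 'rV[R]_n) (us : R -> R) : Prop :=
  (forall i, h i (xs 0) = 0 <-> Gplus h xs 0 i) /\
  (forall i, h i (xs tf) = 0 <-> Gminus h xs tf i) /\
  (forall tau, 0 < tau < tf -> entry_time h xs tau -> ~ {for tau, continuous us}).

(* [ s_u  diag(s) 0 ; hdot_u 0 diag(h) ] at (x,u) *)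
Definition A1mat {R : realType} {n cs ch : nat} (F : 'rV[R]_n -> R -> 'rV[R]_n)
  (s : 'I_cs -> 'rV[R]_n -> R -> R) (h : 'I_ch -> 'rV[R]_n -> R)
  (x : 'rV[R]_n) (u : R) : 'M[R]_(cs + ch, 1 + (cs + ch)) :=
  \matrix_(i, j) match fintype.split j with
                 | inl _ => du (sbar F s h i x) u
                 | inr k => if k == i then cval s h i x u else 0
                 end.

Definition A4mat {R : realType} {n cz : nat} (phi : 'rV[R]_n -> R)
  (z : 'I_cz -> 'rV[R]_n -> R) (x : 'rV[R]_n) : 'M[R]_(1 + cz, n + cz) :=
  \matrix_(i, j) match fintype.split i, fintype.split j with
                 | inl _, inl j' => pd phi j' x
                 | inl _, inr _ => 0
                 | inr k, inl j' => pd (z k) j' x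
                 | inr k, inr k' => if k' == k then z k x else 0
                 end.

Definition bang_ride {R : realType} {n cs ch : nat}
  (s : 'I_cs -> 'rV[R]_n -> R -> R) (h : 'I_ch -> 'rV[R]_n -> R)
  (tf : R) (xs : R -> 'rV[R]_n) (us : R -> R) : Prop :=
  ae_on `[0, tf] (fun t => (exists i, s i (xs t) (us t) = 0) \/
                           (exists i, h i (xs t) = 0)).

Definition is_max_of {R : realType} (D : set R) (u : R) : Prop :=
  D u /\ forall v, D v -> v <= u.

(* Main.v *)
Require Import Defs.
From HB Require Import structures.
From mathcomp Require Import all_boot all_order all_algebra.
From mathcomp Require Import all_classical all_reals all_analysis.
From mathcomp Require Import ring lra.
Set Implicit Arguments. Unset Strict Implicit. Unset Printing Implicit Defensive.
Import Order.TTheory GRing.Theory Num.Theory.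
Import numFieldNormedType.Exports.
Local Open Scope classical_set_scope.
Local Open Scope ring_scope.

(** Let [sigma] be the sum of the costates, i.e. [lambda^T g].  Stationarity
and the sign conditions give [sigma = sum_i m_i] with [m_i >= 0], where
[m_i = - mu_i d(sbar_i)/du], so [sigma >= 0] almost everywhere, and
[lambda_j' = - a_j lambda_j + q_j] with [q_j = sum_i m_i p_(i,j)], which vanishes
wherever [sigma] does.  It remains to exclude [sigma = 0] on a set of positive
measure.

The pairwise order of the costates need not persist in time, so the argument
uses the mean [v] of the costates over the block of indices with maximal [a_j].
For [j] outside the block, [w_j = v - lambda_j] is positive at [tf], and
[w_j' <= - a_j w_j - (a_max - a_j) v].  As [n v = sigma + sum_j w_j], all [w_j > 0]
forces [v > 0], hence [w_j' <= |a_j| w_j]; running backwards from [tf], no [w_j] can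
reach zero.  Thus [v > 0] almost everywhere.

Almost every point of [Z = {sigma = 0}] is an accumulation point of [Z], where the
costate equation is [lambda_j' = - a_j lambda_j]; differentiating repeatedly, all
the moments [sum_j a_j^r lambda_j] vanish almost everywhere on [Z].  A polynomial
killing all [a_j] but the largest turns this into [v = 0], so [Z] is null.

Finally [sigma > 0] makes the Hamiltonian strictly increasing in [u], and a
positive [sum_i m_i] needs an active constraint. *)

(** * Absolutely continuous functions *)

(** The supremum of the points up to which [P] holds throughout satisfies [P] by the limit
    hypothesis, and the step hypothesis would push past it if it were below [b]. *)
Lemma real_induction (R : realType) (a b : R) (P : R -> Prop) :
  a <= b -> P a ->
  (forall c, a <= c < b -> P c ->
     exists2 e, 0 < e & forall d, c < d < c + e -> d <= b -> P d) ->
  (forall c, a < c <= b -> (forall d, a <= d < c -> P d) -> P c) ->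
  forall c, a <= c <= b -> P c.
Proof.
move=> ab Pa step lim.
pose S := [set c | a <= c <= b /\ forall d, a <= d <= c -> P d].
have Sa : S a.
  split=> [|d /andP[ad da]]; first by rewrite lexx.
  by have -> : d = a by apply/le_anti; rewrite ad da.
have hS : has_sup S by split; [exists a | exists b => c [/andP[]]].
have am : a <= sup S by exact: ub_le_sup hS.2 _ Sa.
have mb : sup S <= b by apply: ge_sup; [exists a | move=> c [/andP[]]].
have below d : a <= d < sup S -> P d.
  move=> /andP[ad dm]; have dm0 : 0 < sup S - d by rewrite subr_gt0.
  have [c [_ Pc]] := sup_adherent dm0 hS.
  by rewrite opprB addrC subrK => dc; apply: Pc; rewrite ad ltW.
have Pm : P (sup S).
  have [/eqP <- //|am'] := boolP (a == sup S).
  by apply: lim => //; rewrite lt_neqAle am' am.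
have upto d : a <= d <= sup S -> P d.
  move=> /andP[ad]; rewrite le_eqVlt => /orP[/eqP -> //|dm].
  by apply: below; rewrite ad.
suff mbE : sup S = b by move=> c acb; apply: upto; rewrite mbE.
apply/eqP; rewrite eq_le mb leNgt; apply/negP => mb'.
have [|e e0 ext] := step (sup S) _ Pm; first by rewrite am.
(* Half of [e], because the extension is only granted strictly below [sup S + e]. *)
pose c := Num.min b (sup S + e / 2).
have mc : sup S < c by rewrite lt_min mb' ltrDl divr_gt0.
have Sc : S c.
  split; first by rewrite (le_trans am (ltW mc)) ge_min lexx.
  move=> d /andP[ad dc]; have [dm|md] := leP d (sup S).
    by apply: upto; rewrite ad.
  apply: ext; last by rewrite (le_trans dc)// ge_min lexx.
  rewrite md (le_lt_trans dc)// gt_min; apply/orP; right.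
  by rewrite ltrD2l; lra.
by have := ub_le_sup hS.2 Sc; rewrite leNgt mc.
Qed.

(** The form without a quotient also covers [s = t]. *)
Lemma is_derive_near (R : realType) (w : R -> R) (t D : R) :
  is_derive t (1 : R) w D -> forall e, 0 < e -> exists2 d, 0 < d &
    forall s, `|s - t| < d -> `|w s - w t - D * (s - t)| <= e * `|s - t|.
Proof.
move=> wD e e0.
have /cvgrPdist_le/(_ _ e0) : h^-1 *: (w (h *: 1 + t) - w t) @[h --> 0^'] --> D.
  by case: wD => wd <-; exact: wd.
move=> /nbhs_ballP[d /= d0 wd].
exists d => // s st; have [->|sNt] := eqVneq s t.
  by rewrite !subrr mulr0 subr0 normr0 mulr0.
have st0 : s - t != 0 by rewrite subr_eq0.
have st1 : ball (0 : R) d (s - t) by rewrite -ball_normE /= sub0r normrN.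
have := wd (s - t) st1 st0; rewrite /GRing.scale /= mulr1 subrK => h.
have -> : w s - w t - D * (s - t) =
    - (D - (s - t)^-1 * (w s - w t)) * (s - t) by field.
by rewrite normrM normrN ler_wpM2r.
Qed.

(* Cousin-style argument: points where the derivative is controlled are passed
   by small steps of slope at most K + e, and the null set of other points is
   covered by an open set so small that absolute continuity bounds the
   variation over the steps taken inside it. *)
Lemma abs_cont_le (R : realType) (a b K : R) (w : R -> R) :
  a <= b -> 0 <= K -> abs_cont a b w ->
  ae_on `[a, b] (fun t => exists2 D, is_derive t (1 : R) w D & D <= K) ->
  w b - w a <= K * (b - a).
Proof.
move=> ab K0 acw good; apply/ler_addgt0Pr => e0 e0_gt0.
(* One [e] pays for the excess slope over the length [b - a], another for the variation inside the
   open cover. *)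
pose e := e0 / (b - a + 1).
have ba1 : 0 < b - a + 1 by rewrite ltr_wpDl// subr_ge0.
have e_gt0 : 0 < e by rewrite divr_gt0.
have -> : e0 = e * (b - a) + e by rewrite /e; field; lra.
rewrite addrA -mulrDl.
have [d [d_gt0 acd]] := acw _ e_gt0.
pose N := ~` [set t | `[a, b]%classic t ->
  exists2 D, is_derive t (1 : R) w D & D <= K].
have /negligible_outer_measure N0 : (@lebesgue_measure R).-negligible N.
  exact: good.
(* The measure of the cover is bounded non-strictly, while absolute continuity asks for a total
   length strictly below [d]. *)
have d2 : 0 < d / 2 by rewrite divr_gt0.
have [U [oU NU]] := outer_measure_open_le N d2.
rewrite N0 add0e => Ud.
have mU : measurable U by exact: measurable_realfun.open_measurable.
have goodU t : a <= t <= b -> ~ U t ->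
    exists2 D, is_derive t (1 : R) w D & D <= K.
  move=> abt nUt; have : ~ N t by move/NU.
  by rewrite /N /= not_notE; apply; rewrite /= in_itv.
(* Invariant at [c]: the recorded intervals are no longer in total than the part of [U] before [c],
   and what they do not account for in the increment has slope at most [K + e]. *)
pose P c := exists (m : nat) (lo hi : nat -> R),
  [/\ forall k, (k < m)%N -> a <= lo k /\ lo k <= hi k /\ hi k <= c,
      forall k l, (k < l)%N -> (l < m)%N -> hi k <= lo l,
      ((\sum_(k < m) (hi k - lo k))%:E <=
         @lebesgue_measure R (U `&` `[a, c[))%E &
      w c - w a <= (K + e) * (c - a) + \sum_(k < m) `|w (hi k) - w (lo k)|].
have ext c c' : a <= c -> P c -> c <= c' ->
    (`[c, c'[ `<=` U \/ w c' - w c <= (K + e) * (c' - c)) -> P c'.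
  move=> ac [m [lo [hi [h1 h2 h3 h4]]]] cc' [cU|wc]; last first.
    exists m, lo, hi; split => //.
    - by move=> k km; have [? [? ?]] := h1 k km; do !split=> //; apply: le_trans cc'.
    - apply: (le_trans h3); apply: le_measure; rewrite ?inE.
      + exact: measurableI.
      + exact: measurableI.
      + by apply: setIS; apply: subset_itvl; rewrite bnd_simp.
    - lra.
  exists m.+1, (fun k => if (k < m)%N then lo k else c),
    (fun k => if (k < m)%N then hi k else c'); split.
  - move=> k _; case: ifPn => km; last by [].
    by have [? [? ?]] := h1 k km; do !split=> //; apply: le_trans cc'.
  - move=> k l kl lm; have km : (k < m)%N by apply: leq_trans kl _.
    rewrite km; case: ifPn => lm'; first exact: h2.
    by have [_ []] := h1 k km.
  - rewrite big_ord_recr /= ltnn.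
    under eq_bigr do rewrite ltn_ord.
    have -> : U `&` `[a, c'[ = (U `&` `[a, c[) `|` `[c, c'[.
      apply/seteqP; split=> x /=; rewrite !in_itv /=.
        move=> [Ux /andP[ax xc']]; have [xc|cx] := ltP x c.
          by left; rewrite ax.
        by right.
      move=> [[Ux /andP[ax xc]]|/andP[cx xc']].
        by rewrite ax (lt_le_trans xc cc').
      split; last by rewrite (le_trans ac cx).
      by apply: cU; rewrite /= in_itv /= cx.
    rewrite measureU//; last 2 first.
      exact: measurableI.
      rewrite -subset0 => x /= []; rewrite !in_itv /= => -[_ /andP[_ xc]] /andP[cx _].
      by move: xc; rewrite ltNge cx.
    rewrite EFinD; apply: leeD => //.
    have <- : @lebesgue_measure R `[c, c'[%classic = (c' - c)%:E.
      rewrite lebesgue_measure_itv /= lte_fin.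
      case: ifPn => [_|]; first by rewrite EFinB.
      rewrite -leNgt => c'c; have -> : c' = c by apply/le_anti; rewrite c'c.
      by rewrite subrr.
    exact: lexx.
  - rewrite big_ord_recr /= ltnn.
    under eq_bigr do rewrite ltn_ord.
    have := ler_norm (w c' - w c).
    have : 0 <= (K + e) * (c' - c) by rewrite mulr_ge0 ?subr_ge0//; lra.
    lra.
(* The Cousin gauge: within [r] of [c], every step to or from [c] either lies in [U] or has
   controlled slope. *)
have local c : a <= c <= b -> exists2 r, 0 < r &
    (forall c', c <= c' < c + r -> `[c, c'[ `<=` U \/ w c' - w c <= (K + e) * (c' - c)) /\
    (forall c', c - r < c' <= c -> `[c', c[ `<=` U \/ w c - w c' <= (K + e) * (c - c')).
  move=> abc; have [Uc|nUc] := pselect (U c).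
    have /nbhs_ballP[r /= r0 rU] : nbhs c U by exact: open_nbhs_nbhs.
    exists r => //; split=> c' /andP[h1 h2]; left=> x /=;
      rewrite in_itv /= => /andP[h3 h4]; apply: rU; rewrite -ball_normE /= ltr_norml; apply/andP; split; lra.
  have [D wD DK] := goodU c abc nUc.
  have [r r0 rD] := is_derive_near wD e_gt0.
  exists r => //; split=> c' /andP[h1 h2]; right.
    have := rD c'; rewrite (ger0_norm (_ : 0 <= c' - c)); last by lra.
    have -> : c' - c < r by lra.
    move=> /(_ isT); rewrite ler_norml => /andP[_].
    have : D * (c' - c) <= K * (c' - c) by rewrite ler_wpM2r//; lra.
    lra.
  have := rD c'; rewrite (ler0_norm (_ : c' - c <= 0)); last by lra.
  have -> : - (c' - c) < r by lra.
  move=> /(_ isT); rewrite ler_norml => /andP[+ _].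
  have : D * (c - c') <= K * (c - c') by rewrite ler_wpM2r//; lra.
  lra.
have : P b.
  apply: (@real_induction _ a b) => //; last by rewrite ab lexx.
  - exists 0%N, (fun=> 0), (fun=> 0); split=> //;
      by rewrite !big_ord0 ?subrr ?mulr0 ?addr0.
  - move=> c /andP[ac cb] Pc.
    have [|r r0 [rR _]] := local c; first by rewrite ac ltW.
    exists r => // c' /andP[cc' c'r] c'b; apply: (ext c) => //; first exact: ltW.
    by apply: rR; rewrite ltW.
  - move=> c /andP[ac cb] Pc.
    have [|r r0 [_ rL]] := local c; first by rewrite cb ltW.
    pose c' := Num.max a (c - r / 2).
    have c'c : c' < c by rewrite gt_max ac; lra.
    have ac' : a <= c' by rewrite le_max lexx.
    apply: (ext c') => //; first by apply: Pc; rewrite ac'.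
      exact: ltW.
    apply: rL; rewrite (ltW c'c) andbT lt_max; apply/orP; right; lra.
move=> [m [lo [hi [h1 h2 h3 h4]]]].
have : \sum_(k < m) `|w (hi k) - w (lo k)| < e.
  apply: (acd m (fun k => lo k) (fun k => hi k)).
  - by move=> k; exact: h1.
  - by move=> k l kl; exact: h2.
  - rewrite -lte_fin; apply: (le_lt_trans h3).
    apply: (@le_lt_trans _ _ (lebesgue_measure U)).
      apply: le_measure; rewrite ?inE//; exact: measurableI.
    by apply: (le_lt_trans Ud); rewrite lte_fin; lra.
lra.
Qed.

(** * Almost-everywhere statements on a set *)

Lemma ae_on_impl (R : realType) (A B : set R) (P Q : R -> Prop) :
  (forall t, (A t -> P t) -> B t -> Q t) -> ae_on A P -> ae_on B Q.
Proof.
exact: (@filterS _ _ (ae_filter_ringOfSetsType (@lebesgue_measure R))).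
Qed.

Lemma ae_on_impl2 (R : realType) (A B C : set R) (P Q S : R -> Prop) :
  (forall t, (A t -> P t) -> (B t -> Q t) -> C t -> S t) ->
  ae_on A P -> ae_on B Q -> ae_on C S.
Proof.
exact: (@filterS2 _ _ (ae_filter_ringOfSetsType (@lebesgue_measure R))).
Qed.

Lemma ae_on_and (R : realType) (A : set R) (P Q : R -> Prop) :
  ae_on A P -> ae_on A Q -> ae_on A (fun t => P t /\ Q t).
Proof. by apply: ae_on_impl2 => t AP AQ At; split; auto. Qed.

Lemma ae_on_forall (R : realType) (I : finType) (A : set R)
  (P : I -> R -> Prop) :
  (forall i, ae_on A (P i)) -> ae_on A (fun t => forall i, P i t).
Proof.
move=> aP.
have := @filter_forall _ I (fun i t => A t -> P i t) _
  (ae_filter_ringOfSetsType (@lebesgue_measure R)) aP.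
by apply: (@filterS _ _ (ae_filter_ringOfSetsType (@lebesgue_measure R)))
  => t Pt At i; exact: Pt.
Qed.

Lemma ae_on_foralln (R : realType) (A : set R) (P : nat -> R -> Prop) :
  (forall i, ae_on A (P i)) -> ae_on A (fun t => forall i, P i t).
Proof.
move=> aP.
have := @ae_foralln _ _ _ (@lebesgue_measure R) (fun i t => A t -> P i t) aP.
by apply: (@filterS _ _ (ae_filter_ringOfSetsType (@lebesgue_measure R)))
  => t Pt At i; exact: Pt.
Qed.

Lemma ae_on_notin_countable (R : realType) (A B : set R) :
  countable B -> ae_on A (fun t => ~ B t).
Proof.
move=> cB; exists B; split.
- by apply: countable_measurable => // t; exact: measurable_set1.
- exact: countable_lebesgue_measure0.
- by move=> t /=; apply: contra_notP => nBt _.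
Qed.

(** * Mean value inequalities for piecewise absolutely continuous functions *)

Lemma abs_cont_sub (R : realType) (a b c d : R) (v w : R -> R) :
  a <= c -> d <= b -> (forall t, c <= t <= d -> v t = w t) ->
  abs_cont a b v -> abs_cont c d w.
Proof.
move=> ac db vw acv e e0; have [r [r0 rv]] := acv e e0.
exists r; split=> // m lo hi lohi ord small.
have -> : \sum_(k < m) `|w (hi k) - w (lo k)| =
    \sum_(k < m) `|v (hi k) - v (lo k)|.
  apply: eq_bigr => k _; have [h1 [h2 h3]] := lohi k.
  by rewrite !vw ?h1 ?h3 ?(le_trans h1) ?(le_trans h2).
apply: rv => // k; have [h1 [h2 h3]] := lohi k.
by rewrite h2 (le_trans ac h1) (le_trans h3 db).
Qed.

Lemma abs_cont_lincomb (R : realType) (n : nat) (a b : R) (c : 'I_n -> R)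
  (w : 'I_n -> R -> R) :
  (forall k, abs_cont a b (w k)) -> abs_cont a b (fun t => \sum_k c k * w k t).
Proof.
(* The summand 1 keeps [C] positive when all coefficients vanish and makes the final inequality
   strict. *)
move=> acw e e0; pose C := 1 + \sum_k `|c k|.
have C0 : 0 < C by rewrite ltr_wpDr// sumr_ge0.
have e'0 : 0 < e / C by rewrite divr_gt0.
have /(_ _)/cid-/all_sig[r rP] : forall k, exists r, 0 < r /\
    forall (m : nat) (lo hi : 'I_m -> R),
      (forall k, a <= lo k /\ lo k <= hi k /\ hi k <= b) ->
      (forall k l : 'I_m, (k < l)%N -> hi k <= lo l) ->
      \sum_(k < m) (hi k - lo k) < r ->
      \sum_(l < m) `|w k (hi l) - w k (lo l)| < e / C.
  by move=> k; exact: acw.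
pose d := \big[Num.min/1]_k r k.
have d0 : 0 < d.
  by rewrite /d; elim/big_ind: _ => // [x y x0 y0|k _]; [rewrite lt_min x0|case: (rP k)].
exists d; split=> // m lo hi lohi ord small.
apply: (@le_lt_trans _ _ (\sum_k `|c k| * (e / C))).
  apply: (@le_trans _ _ (\sum_(l < m) \sum_k `|c k| * `|w k (hi l) - w k (lo l)|)).
    apply: ler_sum => l _; rewrite -sumrB (le_trans (ler_norm_sum _ _ _))//.
    by apply: ler_sum => k _; rewrite -mulrBr normrM.
  rewrite exchange_big; apply: ler_sum => k _ /=.
  rewrite -mulr_sumr ler_wpM2l// ltW//; apply: (rP k).2 => //.
  by apply: (lt_le_trans small); rewrite /d (bigD1 k)//= ge_min lexx.
rewrite -mulr_suml mulrCA gtr_pMr// ltr_pdivrMr// mul1r /C; lra.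
Qed.

Lemma cvg_within_near (R : realType) (a b t : R) (w : R -> R) :
  w s @[s --> within `[a, b] (nbhs t)] --> w t ->
  forall e, 0 < e -> exists2 d, 0 < d &
    forall s, a <= s <= b -> `|s - t| < d -> `|w s - w t| < e.
Proof.
move=> wt e e0; have /cvgrPdist_lt/(_ _ e0) := wt.
rewrite near_withinE => /nbhs_ballP[d /= d0 dw]; exists d => // s abs st.
rewrite distrC; apply: dw; first by rewrite -ball_normE /= distrC.
by rewrite /= in_itv.
Qed.

Lemma within_continuous_near (R : realType) (a b : R) (w : R -> R) :
  {within `[a, b], continuous w} ->
  forall t, a <= t <= b -> forall e, 0 < e -> exists2 d, 0 < d &
    forall s, a <= s <= b -> `|s - t| < d -> `|w s - w t| < e.
Proof.
move=> /subspace_continuousP cw t abt.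
by apply: cvg_within_near; apply: cw; rewrite /= in_itv.
Qed.

Lemma within_continuous_lincomb (R : realType) (n : nat) (A : set R)
  (c : 'I_n -> R) (w : R -> 'rV[R]_n) :
  {within A, continuous w} ->
  {within A, continuous (fun t => \sum_k c k * w t 0 k)}.
Proof.
move=> /subspace_continuousP cw; apply/subspace_continuousP => t At.
have cont : continuous (fun y : 'rV[R]_n => \sum_k c k * y 0 k).
  apply: (@continuous_big _ _ +%R 0 xpredT add_continuous) => k _ y.
  by apply: cvgMl_tmp; [exact: (nbhs_filter y)|exact: coord_continuous].
exact: (cvg_comp _ _ (cw t At) (cont (w t))).
Qed.

(** The pieces in [pw_abs_cont] agree with the function only on open intervals. Continuity at [a]
    and [b] makes the two end increments arbitrarily small, so inner intervals suffice. *)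
Lemma locally_abs_cont_le (R : realType) (a b K : R) (w : R -> R) :
  a < b -> 0 <= K -> {within `[a, b], continuous w} ->
  (forall c d, a < c -> c <= d -> d < b -> abs_cont c d w) ->
  ae_on `[a, b] (fun t => exists2 D, is_derive t (1 : R) w D & D <= K) ->
  w b - w a <= K * (b - a).
Proof.
move=> ab K0 /within_continuous_near cw acw good.
apply/ler_addgt0Pr => e e0; have e2 : 0 < e / 2 by rewrite divr_gt0.
have [|r r0 ra] := cw a _ _ e2; first by rewrite lexx ltW.
have [|s s0 sb] := cw b _ _ e2; first by rewrite lexx ltW.
(* Cutting at the midpoint guarantees [c <= d]. *)
pose m := (a + b) / 2.
pose c := Num.min m (a + r / 2); pose d := Num.max m (b - s / 2).
have [ac ca] : a < c /\ c < a + r.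
  by split; rewrite ?lt_min ?gt_min /m; [apply/andP; split|apply/orP; right]; lra.
have [db bd] : d < b /\ b - s < d.
  by split; rewrite ?lt_max ?gt_max /m; [apply/andP; split|apply/orP; right]; lra.
have cm : c <= m by rewrite ge_min lexx.
have md : m <= d by rewrite le_max lexx.
have cd : c <= d by apply: le_trans md.
have wdc : w d - w c <= K * (d - c).
  apply: abs_cont_le => //; first exact: acw.
  apply: ae_on_impl good => t ht; rewrite /= in_itv /= => /andP[ct td].
  by apply: ht; rewrite /= in_itv /=; apply/andP; split; lra.
have hc : `|w c - w a| < e / 2.
  by apply: ra; [apply/andP; split; lra|rewrite ger0_norm; lra].
have hd : `|w d - w b| < e / 2.
  by apply: sb; [apply/andP; split; lra|rewrite ler0_norm; lra].
have : K * (d - c) <= K * (b - a) by rewrite ler_wpM2l//; lra.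
move: hc hd; rewrite !ltr_norml => /andP[? ?] /andP[? ?]; lra.
Qed.

(** The bound is summed over the pieces. Linear combinations of the coordinates are treated because
    both the block mean and its gaps to single costates have this form. *)
Lemma pw_abs_cont_le (R : realType) (n : nat) (tf x y K : R) (c : 'I_n -> R)
  (lam : R -> 'rV[R]_n) (w := fun t => \sum_k c k * lam t 0 k) :
  pw_abs_cont tf lam -> {within `[0, tf], continuous lam} ->
  0 <= x -> x <= y -> y <= tf -> 0 <= K ->
  ae_on `[x, y] (fun t => exists2 D, is_derive t (1 : R) w D & D <= K) ->
  w y - w x <= K * (y - x).
Proof.
move=> [N [tp [tp0 [tpN [tpS pieces]]]]] clam x0 xy ytf K0 good.
(* Breakpoints are clamped to [[x, y]]; a piece outside it collapses to a point and contributes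
   nothing. *)
pose cl k := Num.min (Num.max x (tp k)) y.
have xcl k : x <= cl k by rewrite le_min xy le_max lexx.
have cly k : cl k <= y by rewrite ge_min lexx orbT.
suff H k : (k <= N)%N -> w (cl k) - w x <= K * (cl k - x).
  by have := H N (leqnn N); rewrite /cl tpN max_r ?min_r//; lra.
elim: k => [|k IH] kN.
  by rewrite /cl tp0 max_l// min_l// !subrr mulr0.
have tpk : tp k <= tp k.+1 by rewrite ltW ?tpS.
have clS : cl k <= cl k.+1.
  rewrite /cl le_min ge_min; apply/andP; split; last by rewrite ge_min lexx orbT.
  by rewrite ge_max !le_max lexx tpk orbT.
have := IH (ltnW kN); move: clS; rewrite le_eqVlt => /orP[/eqP <- //|clk].
suff : w (cl k.+1) - w (cl k) <= K * (cl k.+1 - cl k) by lra.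
have tpcl : tp k <= cl k.
  rewrite /cl le_min le_max lexx orbT /= leNgt; apply/negP => yt.
  move: clk; rewrite ltNge => /negP; apply.
  by rewrite {2}/cl min_r ?cly// le_max (ltW yt) orbT.
have cltp : cl k.+1 <= tp k.+1.
  have : x < cl k.+1 by apply: le_lt_trans clk.
  rewrite /cl; have [|xt] := leP x (tp k.+1); first by rewrite ge_min lexx.
  by rewrite min_l// ltxx.
have [wk [wkE acwk]] := pieces k kN.
apply: locally_abs_cont_le => //.
- apply: within_continuous_lincomb; apply: continuous_subspaceW clam.
  move=> t; rewrite /= !in_itv /= => /andP[t1 t2].
  by rewrite (le_trans x0 (le_trans (xcl k) t1)) (le_trans t2 (le_trans (cly _) ytf)).
- move=> a b ca ab bc.
  apply: (@abs_cont_sub _ (tp k) (tp k.+1) _ _ (fun t => \sum_j c j * wk t 0 j)).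
  + by rewrite ltW// (le_lt_trans tpcl ca).
  + by rewrite ltW// (lt_le_trans bc cltp).
  + move=> t /andP[at_ tb]; rewrite wkE//.
    by rewrite (le_lt_trans tpcl (lt_le_trans ca at_))
      (le_lt_trans tb (lt_le_trans bc cltp)).
  + exact: (@abs_cont_lincomb _ _ _ _ c (fun j t => wk t 0 j)).
- apply: ae_on_impl good => t ht; rewrite /= in_itv /= => /andP[t1 t2].
  by apply: ht; rewrite /= in_itv /= (le_trans (xcl k) t1) (le_trans t2 (cly _)).
Qed.

(** If [w a <= 0], then on a short interval [[a, b']] the maximum of [w] is positive, yet the growth
    bound lets [w] rise by at most half of that maximum. *)
Lemma positive_left_end (R : realType) (a b C : R) (w : R -> R) :
  a < b -> 0 <= C -> {within `[a, b], continuous w} ->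
  (forall x y K, a <= x -> x <= y -> y <= b -> 0 <= K ->
     ae_on `[x, y] (fun t => exists2 D, is_derive t (1 : R) w D & D <= K) ->
     w y - w x <= K * (y - x)) ->
  (forall t, a < t <= b -> 0 < w t) ->
  ae_on `[a, b]
    (fun t => a < t -> exists2 D, is_derive t (1 : R) w D & D <= C * w t) ->
  0 < w a.
Proof.
move=> ab C0 cw mvt wpos good; rewrite ltNge; apply/negP => wa.
(* This length makes [C * w c * (c - a)] at most [w c / 2], also when [C = 0]. *)
pose b' := Num.min b (a + (2 * (C + 1))^-1).
have C1 : 0 < (2 * (C + 1))^-1 by rewrite invr_gt0; lra.
have ab' : a < b' by rewrite lt_min ab ltrDl.
have b'b : b' <= b by rewrite ge_min lexx.
have cw' : {within `[a, b'], continuous w}.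
  by apply: continuous_subspaceW cw; apply: subset_itvl; rewrite bnd_simp.
have [c /itvP cab' cmax] := EVT_max (ltW ab') cw'.
have ac0 : a <= c by rewrite cab'.
have cb' : c <= b' by rewrite cab'.
have M0 : 0 < w c.
  apply: (@lt_le_trans _ _ (w b')); first by apply: wpos; rewrite ab'.
  by apply: cmax; rewrite in_itv /= lexx ltW.
have := mvt a c (C * w c) (lexx _) ac0 (le_trans cb' b'b).
rewrite mulr_ge0 ?(ltW M0)// => /(_ isT) H.
have : w c - w a <= C * w c * (c - a).
  apply: H.
  have := @ae_on_notin_countable R `[a, c]%classic [set a] (countable1 a).
  apply: ae_on_impl2 good => t ht nta tac.
  have /andP[at_ tc] : a <= t <= c by move: tac; rewrite /= in_itv.
  have [||D wD Dw] := ht.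
  - by rewrite /= in_itv /= at_ (le_trans tc (le_trans cb' b'b)).
  - rewrite lt_neqAle at_ andbT; apply/eqP => ta.
    by apply: (nta tac) => /=.
  exists D => //; apply: (le_trans Dw); rewrite ler_wpM2l// cmax// in_itv /= at_.
  exact: le_trans cb'.
have : c - a <= (2 * (C + 1))^-1.
  by rewrite lerBlDl (le_trans cb')// ge_min lexx orbT.
move=> /(ler_wpM2l (mulr_ge0 C0 (ltW M0))) h1 h2.
have : C * w c * (2 * (C + 1))^-1 <= w c / 2.
  rewrite invfM; have -> : C * w c * (2^-1 * (C + 1)^-1) =
     (w c / 2) * (C / (C + 1)) by ring.
  rewrite ler_piMr//; first by lra.
  by rewrite ler_pdivrMr ?mul1r; lra.
lra.
Qed.

(** Isolated zeros are countable, hence null; at a zero that is not isolated, difference quotients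
    along other zeros force a zero derivative. *)
Lemma derive_eq0_ae_on_zeros (R : realType) (A : set R) (w : R -> R) :
  ae_on A (fun t => w t = 0 -> forall D, is_derive t (1 : R) w D -> D = 0).
Proof.
have := @ae_on_notin_countable R A _ (@countable_isolated R [set t | w t = 0]).
apply: ae_on_impl => t + At => /(_ At) niso wt0 D wD.
apply/eqP/negPn/negP => D0; apply: niso; split; first by rewrite inE.
(* A nearby zero [s] would give [|D| |s - t| <= |D| |s - t| / 2], so [s = t] and [t] would be
   isolated. *)
have D2 : 0 < `|D| / 2 by rewrite divr_gt0// normr_gt0.
have [d d0 wd] := is_derive_near wD D2.
exists (ball t d); first exact: nbhsx_ballx.
apply/seteqP; split=> [s /= [ts ws0]|s -> /=]; last first.
  by split => //; exact: ballxx.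
have := wd s; rewrite distrC => /(_ ts); rewrite ws0 wt0 subrr sub0r normrN normrM.
move=> H; apply/eqP/negPn/negP => sNt.
have st0 : 0 < `|s - t| by rewrite normr_gt0 subr_eq0.
by rewrite (distrC t) ler_pM2r in H; lra.
Qed.

(** * The costate equation *)

Lemma is_derive_lincomb (R : realType) (n : nat) (t : R) (c : 'I_n -> R)
  (w : 'I_n -> R -> R) (dw : 'I_n -> R) :
  (forall k, is_derive t (1 : R) (w k) (dw k)) ->
  is_derive t (1 : R) (fun s => \sum_k c k * w k s) (\sum_k c k * dw k).
Proof.
move=> wd; have -> : (fun s => \sum_k c k * w k s) = \sum_k (c k *: w k).
  by apply/funext => s; rewrite fct_sumE.
exact: is_derive_sum.
Qed.

(** Combining the moments with the coefficients of a polynomial that vanishes at every [a j] other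
    than [b] isolates the block at [b], up to the nonzero factor [p.[b]]. *)
Lemma sum_eq0_of_moments (F : fieldType) (n : nat) (a lam : 'I_n -> F) (b : F) :
  (forall r, \sum_k a k ^+ r * lam k = 0) -> \sum_(k | a k == b) lam k = 0.
Proof.
move=> mom; pose p := \prod_(j | a j != b) ('X - (a j)%:P).
have p0 k : a k != b -> p.[a k] = 0.
  by move=> akb; rewrite /p horner_prod (bigD1 k)//= !hornerE subrr mul0r.
have pb : p.[b] != 0.
  rewrite /p horner_prod; apply/prodf_neq0 => j ajb.
  by rewrite !hornerE subr_eq0 eq_sym.
have : \sum_k p.[a k] * lam k = 0.
  under eq_bigr do rewrite horner_coef mulr_suml.
  rewrite exchange_big big1 //= => r _.
  by under eq_bigr do rewrite -mulrA; rewrite -mulr_sumr mom mulr0.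
rewrite (bigID (fun k => a k == b)) /= [X in _ + X]big1 ?addr0; last first.
  by move=> k akb; rewrite p0// mul0r.
under eq_bigr => k /eqP akb do rewrite akb.
by rewrite -mulr_sumr => /eqP; rewrite mulf_eq0 (negPf pb) => /eqP.
Qed.

(** * Positivity of the costate sum for the equation [lambda_j' = - a_j lambda_j + q_j] *)

Section costate.
Variables (R : realType) (n : nat) (tf : R) (a : 'I_n -> R).
Variables (lam : R -> 'rV[R]_n) (q : R -> 'I_n -> R).
Hypothesis tf_gt0 : 0 < tf.
Hypothesis lam_ac : pw_abs_cont tf lam.
Hypothesis lam_cont : {within `[0, tf], continuous lam}.
Hypothesis lam_a : forall k j, lam tf 0 j <= lam tf 0 k -> a j <= a k.
Hypothesis lam_ode : ae_on `[0, tf] (fun t => [/\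
  forall j, is_derive t (1 : R) (fun s => lam s 0 j) (- a j * lam t 0 j + q t j),
  0 <= \sum_k lam t 0 k,
  forall k j, lam tf 0 j <= lam tf 0 k -> q t k <= q t j &
  \sum_k lam t 0 k = 0 -> forall j, q t j = 0]).

(** Where the sum vanishes so does [q], and the derivative of the moment of order [r] is then minus
    the moment of order [r + 1]. *)
Lemma moments_eq0_ae r : ae_on `[0, tf]
  (fun t => \sum_k lam t 0 k = 0 -> \sum_k a k ^+ r * lam t 0 k = 0).
Proof.
elim: r => [|r IH].
  apply: ae_on_impl lam_ode => t _ _ s0; rewrite -[RHS]s0.
  by apply: eq_bigr => k _; rewrite expr0 mul1r.
have zero := @derive_eq0_ae_on_zeros R `[0, tf]%classic
  (fun t => \sum_k a k ^+ r * lam t 0 k).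
have := ae_on_and zero IH.
apply: ae_on_impl2 lam_ode => t /[swap] h /[swap] At /(_ At)[ode _ _ q0] s0.
have [der M0] := h At.
have := der (M0 s0) _ (is_derive_lincomb (fun k => a k ^+ r) ode).
under eq_bigr do rewrite (q0 s0) addr0 mulNr mulrN mulrA -exprSr.
by rewrite sumrN => /eqP; rewrite oppr_eq0 => /eqP.
Qed.

Variable T : 'I_n.
Hypothesis aT : forall j, a j <= a T.

Let top := [pred k | a k == a T].
Let r : R := #|top|%:R.
Let v t := r^-1 * \sum_(k in top) lam t 0 k.

Let r_gt0 : 0 < r.
Proof. by rewrite ltr0n; apply/card_gt0P; exists T; rewrite inE. Qed.

Let topP j k : j \notin top -> k \in top -> lam tf 0 j < lam tf 0 k.
Proof.
rewrite !inE => jT /eqP kT; rewrite ltNge; apply/negP => /lam_a.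
by rewrite kT leNgt lt_neqAle jT aT.
Qed.

(** Coefficients writing the gap [v - lambda_j] as one linear combination of the costates, the form
    required by [pw_abs_cont_le] and [is_derive_lincomb]. *)
Let gap_coef j k : R := r^-1 * (k \in top)%:R - (k == j)%:R.

Let gapE j (x : 'I_n -> R) :
  r^-1 * (\sum_(k in top) x k) - x j = \sum_k gap_coef j k * x k.
Proof.
under [RHS]eq_bigr do rewrite mulrBl -mulrA.
rewrite sumrB -mulr_sumr; congr (_ * _ - _).
  by rewrite big_mkcond; apply: eq_bigr => k _; case: ifP; rewrite ?mul1r ?mul0r.
rewrite (bigD1 j)//= eqxx mul1r big1 ?addr0// => k kj.
by rewrite (negPf kj) mul0r.
Qed.

Let gap_funE j :
  (fun t => v t - lam t 0 j) = (fun t => \sum_k gap_coef j k * lam t 0 k).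
Proof. by apply/funext => t; exact: gapE. Qed.

(* The deviations from the mean over the top block add up to zero over it. *)
Let mean_top t : n%:R * v t =
  \sum_k lam t 0 k + \sum_(k | k \notin top) (v t - lam t 0 k).
Proof.
have -> : n%:R * v t = \sum_(k < n) v t.
  by rewrite sumr_const card_ord mulr_natl.
rewrite -[LHS](subrK (\sum_k lam t 0 k)) addrC -sumrB; congr (_ + _).
rewrite (bigID (mem top)) /= sumrB sumr_const -[v t *+ _]mulr_natl /v.
by rewrite mulrA divff ?gt_eqF// mul1r subrr add0r.
Qed.

Let gap_pos_top t j0 : j0 \notin top -> 0 <= \sum_k lam t 0 k ->
  (forall j, j \notin top -> 0 < v t - lam t 0 j) -> 0 < v t.
Proof.
move=> j0T s0 gap; have n0 : 0 < n%:R :> R.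
  by rewrite ltr0n; case: (n) T => // -[].
rewrite -(pmulr_rgt0 _ n0) mean_top ltr_wpDl// (bigD1 j0)//= ltr_pwDl ?gap//.
by apply: sumr_ge0 => j /andP[jT _]; rewrite ltW ?gap.
Qed.

Lemma top_gap_pos t j : 0 <= t <= tf -> j \notin top -> 0 < v t - lam t 0 j.
Proof.
(* Time is reversed so that real induction starts from [tf]; all gaps are carried together, since
   positivity of [v] needs all of them. *)
pose P s := forall j, j \notin top -> 0 < v (tf - s) - lam (tf - s) 0 j.
suff : forall s, 0 <= s <= tf -> P s.
  move=> H /andP[t0 ttf] jT; have := H (tf - t); rewrite /P subKr; apply => //.
  by apply/andP; split; lra.
have gap_cont i : {within `[0, tf], continuous (fun t => v t - lam t 0 i)}.
  rewrite gap_funE; exact: within_continuous_lincomb.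
apply: real_induction; first exact: ltW.
(* At [tf] the gap is an average of differences that are all positive by [topP]; [T] shows that the
   block is nonempty. *)
- move=> i iT; rewrite subr0 /v gapE.
  have -> : \sum_k gap_coef i k * lam tf 0 k =
      r^-1 * \sum_(k in top) (lam tf 0 k - lam tf 0 i).
    rewrite -gapE sumrB sumr_const -[_ *+ _]mulr_natl mulrBr.
    by rewrite mulKf ?gt_eqF.
  rewrite mulr_gt0 ?invr_gt0// (bigD1 T) ?inE//= ltr_pwDl//.
    by rewrite subr_gt0 topP// inE.
  by apply: sumr_ge0 => k /andP[kT _]; rewrite subr_ge0 ltW ?topP.
- move=> s /andP[s0 stf] Ps.
  have near_s i : exists d, 0 < d /\ forall s', s < s' < s + d -> s' <= tf ->
      i \notin top -> 0 < v (tf - s') - lam (tf - s') 0 i.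
    have [iT|iT] := boolP (i \in top); first by exists 1; split.
    have /within_continuous_near H := gap_cont i.
    have [|d d0 dP] := H (tf - s) _ _ (Ps i iT); first by apply/andP; split; lra.
    exists d; split=> // s' /andP[ss' s'd] s'tf _.
    have := dP (tf - s'); have -> : 0 <= tf - s' <= tf by apply/andP; split; lra.
    have -> : tf - s' - (tf - s) = - (s' - s) by ring.
    rewrite normrN gtr0_norm ?subr_gt0//; have -> : s' - s < d by lra.
    move=> /(_ isT isT); rewrite ltr_norml => /andP[+ _]; lra.
  have /all_sig[d dP] := fun i => cid (near_s i).
  exists (\big[Num.min/1]_i d i).
    by elim/big_ind: _ => // [x y x0 y0|i _]; [rewrite lt_min x0|case: (dP i)].
  move=> s' /andP[ss' s'd] s'tf i iT; apply: (dP i).2 => //.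
  rewrite ss' (lt_le_trans s'd)// lerD2l (bigD1 i)//= ge_min lexx //.
(* Limit case: the gaps are positive after [tf - s], and [positive_left_end] with [C = |a i|]
   carries this to [tf - s] itself. *)
- move=> s /andP[s0 stf] Ps i iT.
  have Pt t' : tf - s < t' <= tf ->
      forall k, k \notin top -> 0 < v t' - lam t' 0 k.
    move=> /andP[st' t'tf] k kT; have := Ps (tf - t'); rewrite /P subKr; apply => //.
    by apply/andP; split; lra.
  have stf0 : tf - s < tf by lra.
  apply: (@positive_left_end _ _ tf `|a i| (fun t => v t - lam t 0 i)) => //.
  + by apply: continuous_subspaceW (gap_cont i); apply: subset_itvr;
      rewrite bnd_simp; lra.
  + rewrite gap_funE => x y K xs xy ytf K0 H.
    by rewrite !gapE; apply: (@pw_abs_cont_le _ _ tf) => //; lra.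
  + by move=> t' t'P; apply: Pt.
  + apply: ae_on_impl lam_ode => t' ode; rewrite /= in_itv /= => t'I st'.
    have t'tf : t' <= tf by case/andP: t'I.
    have [] := ode; first by rewrite /= in_itv /= t'tf andbT; lra.
    move=> lamd sge0 qmono _.
    have gaps := Pt t' (introT andP (conj st' t'tf)).
    have vpos := gap_pos_top iT sge0 gaps.
    have der := is_derive_lincomb (gap_coef i) lamd.
    exists (\sum_k gap_coef i k * (- a k * lam t' 0 k + q t' k)).
      by rewrite gap_funE.
    have gi := gaps i iT.
    rewrite -gapE big_split /= mulrDr.
    have -> : \sum_(k in top) - a k * lam t' 0 k =
        - a T * \sum_(k in top) lam t' 0 k.
      by rewrite mulr_sumr; apply: eq_bigr => k; rewrite inE => /eqP ->.
    rewrite mulrCA -/(v t').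
    (* Block members have larger final costates than [i], so each of their [q] is at most that of
       [i], and so is the average. *)
    have qi : r^-1 * \sum_(k in top) q t' k <= q t' i.
      rewrite ler_pdivrMl// mulr_natl -sumr_const.
      by apply: ler_sum => k kT; apply: qmono; rewrite ltW ?topP.
    have : - a i * (v t' - lam t' 0 i) <= `|a i| * (v t' - lam t' 0 i).
      by rewrite ler_wpM2r ?(ltW gi)// -normrN ler_norm.
    (* The derivative of the gap equals [- a_i (v - lambda_i) - (a_T - a_i) v] plus the average of
       [q] over the block minus [q_i]; the last two contributions are nonpositive. *)
    have : 0 <= (a T - a i) * v t' by rewrite mulr_ge0 ?(ltW vpos)// subr_ge0.
    lra.
Qed.

(** [gap_pos_top] asks only for a nonnegative sum, so it yields [0 < v t] even at a zero of the sum,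
    where the vanishing moments give [v t = 0]. *)
Lemma costate_sum_gt0 j0 : a j0 < a T ->
  ae_on `[0, tf] (fun t => 0 < \sum_k lam t 0 k).
Proof.
move=> aj0; have j0T : j0 \notin top by rewrite inE lt_eqF.
have mom : ae_on `[0, tf] (fun t => \sum_k lam t 0 k = 0 ->
    forall r, \sum_k a k ^+ r * lam t 0 k = 0).
  apply: (ae_on_impl (A := `[0, tf]%classic) (P := fun t => forall r, \sum_k lam t 0 k = 0 ->
      \sum_k a k ^+ r * lam t 0 k = 0)) => [t H At s0 i|]; first exact: H.
  apply: ae_on_foralln => i. exact: moments_eq0_ae.
apply: ae_on_impl2 lam_ode mom => t + + At => /(_ At)[_ sge0 _ _] /(_ At) momt.
rewrite lt_neqAle sge0 andbT eq_sym; apply/eqP => s0.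
have vt0 : v t = 0 by rewrite /v (sum_eq0_of_moments _ (momt s0)) mulr0.
have tI : 0 <= t <= tf by move: At; rewrite /= in_itv.
have := gap_pos_top j0T sge0 (fun j => @top_gap_pos t j tI).
by rewrite vt0 ltxx.
Qed.
End costate.

(** * Joint continuity of the constraints *)

Lemma continuous_near_norm_le (R : realType) (T : topologicalType) (f : T -> R)
  (x : T) (M : R) :
  {for x, continuous f} -> `|f x| < M -> \forall y \near x, `|f y| <= M.
Proof. by move=> cf fM; exact: (cvgr_norm_le (f x) cf). Qed.

Lemma is_derive_line (R : realType) (V : normedModType R) (f : V -> R)
  (z e : V) (h : R) :
  derivable f (z + h *: e) e ->
  is_derive h (1 : R) (fun k => f (z + k *: e)) ('D_e f (z + h *: e)).
Proof.
move=> df.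
have E : (fun k : R => k^-1 *: (((fun l => f (z + l *: e)) \o shift h) (k *: 1)
            - f (z + h *: e))) =
    (fun k : R => k^-1 *: ((f \o shift (z + h *: e)) (k *: e) - f (z + h *: e))).
  apply/funext => k /=; congr (_ *: (f _ - _)).
  have -> : k *: (1 : R) = k := mulr1 k.
  by rewrite scalerDl addrCA.
by split; rewrite /derivable /derive E.
Qed.

(** The mean value theorem along the line through [z] in direction [e], applied on [[0, c]] or
    [[c, 0]] according to the sign of [c]. *)
Lemma line_increment_le (R : realType) (V : normedModType R) (f : V -> R)
  (z e : V) (M c : R) :
  (forall h, derivable f (z + h *: e) e) ->
  (forall h, `|h| <= `|c| -> `|'D_e f (z + h *: e)| <= M) ->
  `|f (z + c *: e) - f z| <= M * `|c|.
Proof.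
move=> df fM; pose g k := f (z + k *: e).
have dg h : is_derive h (1 : R) g ('D_e f (z + h *: e)).
  exact: is_derive_line.
have cg a b : {within `[a, b], continuous g}.
  by apply: derivable_within_continuous => x _; case: (dg x).
have -> : f (z + c *: e) - f z = g c - g 0 by rewrite /g scale0r addr0.
have [c0|c0] := leP 0 c.
  have [x /itvP xc ->] := MVT_segment c0 (fun x _ => dg x) (cg _ _).
  rewrite subr0 normrM ler_wpM2r// fM// !ger0_norm ?xc//.
have [x /itvP xc] := MVT_segment (ltW c0) (fun x _ => dg x) (cg _ _).
rewrite distrC => ->; rewrite sub0r normrM normrN ler_wpM2r// fM//.
by rewrite !ler0_norm ?xc ?(ltW c0)// lerN2 xc.
Qed.

(** [C1xu] only speaks of partial derivatives. Being continuous, they are bounded by some [M] near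
    the point; changing the input and then the coordinates one at a time bounds the increment. *)
Lemma C1xu_near (R : realType) (n : nat) (q : 'rV[R]_n -> R -> R)
  (x : 'rV[R]_n) (v e : R) :
  C1xu q -> 0 < e -> exists2 d, 0 < d & forall (y : 'rV[R]_n) (u : R),
    (forall j, `|y 0 j - x 0 j| < d) -> `|u - v| < d ->
    `|q y u - q x v| < e.
Proof.
move=> [dx [dv [cx cv]]] e0.
pose M := 1 + `|du (q x) v| + \sum_j `|pd (q ^~ v) j x|.
have sum0 : 0 <= \sum_j `|pd (q ^~ v) j x| by apply: sumr_ge0.
have M0 : 0 < M by have := normr_ge0 (du (q x) v); rewrite /M; lra.
have [r [r0 rx rv]] : exists r, [/\ 0 < r,
    forall j (y : 'rV[R]_n) u, (forall k, `|y 0 k - x 0 k| < r) -> `|u - v| < r ->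
      `|pd (q ^~ u) j y| <= M &
    forall u, `|u - v| < r -> `|du (q x) u| <= M].
  have near_x : \forall p \near (x, v), forall j, `|pd (q ^~ p.2) j p.1| <= M.
    apply: (filter_forall (nbhs_filter (x, v))) => j.
    apply: (continuous_near_norm_le (cx j (x, v))) => /=.
    rewrite /M (bigD1 j)//=; have := normr_ge0 (du (q x) v).
    have : 0 <= \sum_(i < n | i != j) `|pd (q ^~ v) i x| by apply: sumr_ge0.
    by set A := \sum_(i < n | _) _; set B := `|_|; set D := `|_|; lra.
  have near_v : \forall p \near (x, v), `|du (q p.1) p.2| <= M.
    by apply: (continuous_near_norm_le (cv (x, v))) => /=; rewrite /M; lra.
  have [[A B] /= [/nbhs_ballP[r1 /= r10 r1A] /nbhs_ballP[r2 /= r20 r2B]] AB] :=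
    filterI near_x near_v.
  exists (Num.min r1 r2); split; first by rewrite lt_min r10.
  - move=> j y u yx uv; have [|+ _] := AB (y, u); last exact.
    split; [apply: r1A; split=> [|i k]; first exact: r10|apply: r2B].
      by rewrite ord1 /= -ball_normE /= distrC (lt_le_trans (yx k))// ge_min lexx.
    by rewrite -ball_normE /= distrC (lt_le_trans uv)// ge_min lexx orbT.
  - move=> u uv; have [|_] := AB (x, u); last exact.
    split; [by apply: r1A; exact: ballxx|apply: r2B].
    by rewrite -ball_normE /= distrC (lt_le_trans uv)// ge_min lexx orbT.
(* There are [n + 1] moves of size at most [M * d]; dividing by [n + 2] makes the total strictly
   less than [e]. *)
pose d := Num.min r (e / (M * (n.+2)%:R)).
have Mn : 0 < M * (n.+2)%:R by rewrite mulr_gt0// ltr0n.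
have d0 : 0 < d by rewrite lt_min r0 divr_gt0.
exists d => // y u yd ud.
have dr : d <= r by rewrite ge_min lexx.
have qv : `|q x u - q x v| <= M * d.
  have -> : u = v + (u - v) *: 1 by rewrite /GRing.scale /= mulr1 addrC subrK.
  apply: (@le_trans _ _ (M * `|u - v|)); last by rewrite ler_wpM2l// ltW.
  apply: line_increment_le => [h|h hu]; first exact: dv.
  apply: rv; rewrite /GRing.scale /= mulr1 addrAC subrr add0r.
  by rewrite (le_lt_trans hu)// (lt_le_trans ud).
(* Hybrid points: the first [k] coordinates have already been moved to those of [y]. *)
pose z k : 'rV[R]_n := \row_j if (j < k)%N then y 0 j else x 0 j.
have qz k : (k <= n)%N -> `|q (z k) u - q x u| <= k%:R * (M * d).
  elim: k => [_|k IH kn].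
    have -> : z 0%N = x by apply/rowP => j; rewrite mxE ltn0.
    by rewrite subrr normr0 mul0r.
  have := IH (ltnW kn); pose i := Ordinal kn.
  have zS : z k.+1 = z k + (y 0 i - x 0 i) *: delta_mx 0 i.
    apply/rowP => j; rewrite !mxE eqxx /= ltnS leq_eqVlt.
    have [->|ji] := eqVneq j i; first by rewrite eqxx ltnn mulr1 addrC subrK.
    by rewrite (_ : (j == k :> nat) = false) ?mulr0 ?addr0//; apply/eqP => jk;
      move/eqP: ji; apply; apply/val_inj.
  have : `|q (z k.+1) u - q (z k) u| <= M * d.
    rewrite zS; apply: (@le_trans _ _ (M * `|y 0 i - x 0 i|)); last first.
      by rewrite ler_wpM2l ?(ltW M0)// ltW.
    apply: (@line_increment_le _ _ (q ^~ u)) => [h|h hi]; first exact: dx.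
    apply: rx; last exact: (lt_le_trans ud).
    move=> j; rewrite !mxE eqxx /=; have [->|ji] := eqVneq j i.
      rewrite ltnn mulr1 addrAC subrr add0r (le_lt_trans hi)//.
      exact: (lt_le_trans (yd i)).
    rewrite mulr0 addr0; case: ifP => _; first exact: (lt_le_trans (yd j)).
    by rewrite subrr normr0.
  have -> : q (z k.+1) u - q x u =
    (q (z k.+1) u - q (z k) u) + (q (z k) u - q x u) by ring.
  have := ler_normD (q (z k.+1) u - q (z k) u) (q (z k) u - q x u).
  rewrite -natr1; lra.
have zn : z n = y by apply/rowP => j; rewrite mxE ltn_ord.
have := qz n (leqnn n); rewrite zn.
have -> : q y u - q x v = (q y u - q x u) + (q x u - q x v) by ring.
have := ler_normD (q y u - q x u) (q x u - q x v).
have : (n%:R + 2) * (M * d) <= e.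
  rewrite mulrA; have -> : (n%:R + 2) * M = M * n.+2%:R.
    by rewrite mulrC -[n.+2]addn2 natrD.
  by rewrite mulrC -ler_pdivlMr// ge_min lexx orbT.
have : 0 < M * d by rewrite mulr_gt0.
lra.
Qed.

(** Lets state constraints share the continuity argument of the mixed ones. *)
Lemma C1x_C1xu (R : realType) (n : nat) (h : 'rV[R]_n -> R) :
  C1x h -> C1xu (fun x (_ : R) => h x).
Proof.
move=> Ch; split; [|split; [|split]].
- by move=> j x _; case: (Ch j).
- by move=> x u; exact: derivable_cst.
- move=> j p; have [_ cj] := Ch j.
  have c : continuous (pd h j \o (fun p : 'rV[R]_n * R => p.1)).
    by move=> p'; apply: continuous_comp; [exact: cvg_fst|exact: cj].
  exact: (c p).
- rewrite /du (_ : (fun p => _) = cst 0); first exact: cst_continuous.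
  by apply/funext => p; rewrite derive_cst.
Qed.

(** * Multipliers and stationarity *)

Lemma ae_on_witness (R : realType) (A : set R) (P : R -> Prop) (c d : R) :
  c < d -> `]c, d[ `<=` A -> ae_on A P -> exists2 t, c < t < d & P t.
Proof.
move=> cd cdA [N [mN N0 PN]]; apply: contrapT => nP.
have cdN : `]c, d[ `<=` N.
  move=> t tcd; apply: PN => /= H; apply: nP; exists t; last exact/H/cdA.
  by move: tcd; rewrite /= in_itv.
have : (@lebesgue_measure R `]c, d[%classic <= lebesgue_measure N)%E.
  by apply: le_measure; rewrite ?inE.
rewrite [X in (_ <= X)%E -> _]N0 lebesgue_measure_itv /= lte_fin cd -EFinB lee_fin.
by rewrite leNgt subr_gt0 cd.
Qed.

Lemma notin_seq_near (R : realType) (D : seq R) (t : R) :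
  t \notin D -> exists2 d, 0 < d & forall s, `|s - t| < d -> s \notin D.
Proof.
elim: D => [|x D IH]; first by exists 1.
rewrite inE negb_or => /andP[tx /IH[d d0 dD]].
exists (Num.min d `|x - t|).
  by rewrite lt_min d0 normr_gt0 subr_eq0 eq_sym.
move=> s; rewrite lt_min inE negb_or => /andP[sd sx].
by rewrite dD// andbT; apply: contraTN sx => /eqP ->; rewrite ltxx.
Qed.

(** A multiplier that is nonzero at a continuity point stays nonzero on an interval; there
    complementarity gives [E = 0] almost everywhere, hence everywhere by continuity of [E]. This
    supplies the interval of activity that the sensitivity hypothesis requires. *)
Lemma active_near_nonzero_multiplier (R : realType) (tf t0 : R) (m E : R -> R)
  (D : seq R) :
  (forall t, 0 <= t <= tf -> t \notin D -> forall e, 0 < e -> exists2 d, 0 < d &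
    forall s, 0 <= s <= tf -> `|s - t| < d -> `|E s - E t| < e) ->
  (forall e, 0 < e -> exists2 d, 0 < d &
    forall s, 0 <= s <= tf -> `|s - t0| < d -> `|m s - m t0| < e) ->
  ae_on `[0, tf] (fun t => m t * E t = 0) ->
  0 < t0 < tf -> t0 \notin D -> m t0 != 0 ->
  exists a0 b0, 0 <= a0 /\ a0 < b0 /\ b0 <= tf /\
    forall t, a0 < t < b0 -> E t = 0.
Proof.
move=> Ec mc mE /andP[t00 t0tf] t0D mt0.
have [d1 d10 d1D] := notin_seq_near t0D.
have [|d2 d20 d2m] := mc `|m t0|; first by rewrite normr_gt0.
pose d := Num.min (Num.min d1 d2) (Num.min t0 (tf - t0)).
have d0 : 0 < d by rewrite !lt_min d10 d20 t00 subr_gt0.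
have [dd1 dd2] : d <= d1 /\ d <= d2 by rewrite !ge_min !lexx ?orbT.
have [dt0 dtf] : d <= t0 /\ d <= tf - t0 by rewrite !ge_min !lexx ?orbT.
have nearI t : t0 - d < t < t0 + d -> `|t - t0| < d /\ 0 <= t <= tf.
  move=> /andP[h1 h2]; split; last by apply/andP; split; lra.
  by rewrite ltr_norml; apply/andP; split; lra.
have mN0 t : t0 - d < t < t0 + d -> m t != 0.
  move=> /nearI[td tI]; have := d2m t tI (lt_le_trans td dd2).
  by apply: contraTN => /eqP ->; rewrite sub0r normrN ltxx.
exists (t0 - d), (t0 + d); do 3 (split; first by lra).
move=> t td; apply/eqP/negPn/negP => Et.
have [tt0 tI] := nearI t td.
have [|r r0 rE] := Ec t tI (d1D t (lt_le_trans tt0 dd1)) `|E t|.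
  by rewrite normr_gt0.
move: td => /andP[td1 td2].
pose c' := Num.max (t0 - d) (t - r); pose d' := Num.min (t0 + d) (t + r).
have c't : c' < t by rewrite gt_max td1; lra.
have td' : t < d' by rewrite lt_min td2; lra.
have [|s sI mEs] := ae_on_witness (lt_trans c't td') _ mE.
  move=> s; rewrite /= !in_itv /= gt_max lt_min => /andP[/andP[? ?] /andP[? ?]].
  by apply/andP; split; lra.
move: sI; rewrite gt_max lt_min => /andP[/andP[s1 s2] /andP[s3 s4]].
have sd : t0 - d < s < t0 + d by rewrite s1.
have [_ s0tf] := nearI s sd.
have st : `|s - t| < r by rewrite ltr_norml; apply/andP; split; lra.
have := rE s s0tf st; move/eqP: mEs.
rewrite mulf_eq0 (negPf (mN0 s sd)) /= => /eqP ->.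
by rewrite sub0r normrN ltxx.
Qed.

Lemma derive_affine (R : realType) (V : normedModType R) (f : V -> R)
  (x e : V) (c : R) :
  (forall h : R, f (h *: e + x) = f x + h * c) -> 'D_e f x = c.
Proof.
move=> fE; apply: cvg_lim => //; apply: cvg_near_cst.
near=> h; rewrite /= fE addrAC subrr add0r.
rewrite [_ *: _]mulrA mulVf ?mul1r//.
by near: h; exact: nbhs_dnbhs_neq.
Unshelve. all: by end_near. Qed.

Lemma pd_diag (R : realType) (n : nat) (a : 'I_n -> R) (x : 'rV[R]_n) (u : R)
  (j k : 'I_n) :
  pd (fun y => Fsys (fdiag a) (@gone R n) y u 0 k) j x = a k * (k == j)%:R.
Proof.
apply: derive_affine => h; rewrite !mxE eqxx /=; ring.
Qed.

Lemma is_derive_coord (R : realType) (n : nat) (lam : R -> 'rV[R]_n) (t : R)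
  (d : 'rV[R]_n) (j : 'I_n) :
  is_derive t (1 : R) lam d ->
  is_derive t (1 : R) (fun s => lam s 0 j) (d 0 j).
Proof.
case=> dlam <-; split; first by have /derivable_mxP := dlam; exact.
by rewrite derive_mx// mxE.
Qed.

(** * Sign and order consequences of stationarity at a fixed time *)

Section stationarity.
Variables (R : realType) (I : finType) (n : nat) (sigma : R) (m d : I -> R).
Variables (px : I -> 'I_n -> R) (le : rel 'I_n).
Hypothesis m_le0 : forall i, m i <= 0.
Hypothesis d_px : forall i, m i != 0 -> 0 < d i /\
  forall k j, le j k -> (d i)^-1 * px i k <= (d i)^-1 * px i j.
Hypothesis stat : sigma + \sum_i m i * d i = 0.

Let md_le0 i : m i * d i <= 0.
Proof.
have [->|mi] := eqVneq (m i) 0; first by rewrite mul0r.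
by rewrite mulr_le0_ge0// ltW//; case: (d_px mi).
Qed.

Let sigmaE : sigma = \sum_i - (m i * d i).
Proof. by rewrite sumrN; apply/eqP; rewrite -addr_eq0 stat. Qed.

Lemma stationary_ge0 : 0 <= sigma.
Proof. by rewrite sigmaE; apply: sumr_ge0 => i _; rewrite oppr_ge0. Qed.

(** [sigma] is a sum of nonnegative terms [- m_i d_i], so each vanishes, and a nonzero [m_i] would
    come with [d_i > 0]. *)
Lemma stationary_multiplier_eq0 : sigma = 0 -> forall i, m i = 0.
Proof.
rewrite sigmaE => s0 i; apply/eqP/negPn/negP => mi; have [di _] := d_px mi.
have pos k : true -> 0 <= - (m k * d k) by rewrite oppr_ge0.
have /eqP := psumr_eq0P pos s0 isT (i := i).
by rewrite oppr_eq0 mulf_eq0 (negPf mi) gt_eqF.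
Qed.

(** Positive [d_i] can be cleared from the sensitivities; the order is then reversed by [m_i <= 0]
    and again by the outer sign. *)
Lemma stationary_mono k j : le j k ->
  - (\sum_i m i * px i k) <= - (\sum_i m i * px i j).
Proof.
move=> jk; rewrite lerN2; apply: ler_sum => i _.
have [->|mi] := eqVneq (m i) 0; first by rewrite !mul0r.
have [di /(_ k j jk)] := d_px mi.
by rewrite ler_pM2l ?invr_gt0// => pkj; rewrite ler_wnM2l.
Qed.

End stationarity.

Lemma rV_cvg_within_near (R : realType) (n : nat) (a b t : R)
  (w : R -> 'rV[R]_n) :
  w s @[s --> within `[a, b] (nbhs t)] --> w t ->
  forall e, 0 < e -> exists2 d, 0 < d & forall s, a <= s <= b ->
    `|s - t| < d -> forall j, `|w s 0 j - w t 0 j| < e.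
Proof.
move=> wt e e0; have := wt _ (nbhsx_ballx (w t) e e0).
move=> /nbhs_ballP[d /= d0 dw]; exists d => // s sab st j.
have sd : ball t d s by rewrite -ball_normE /= distrC.
have sI : `[a, b]%classic s by rewrite /= in_itv.
by have [_ /(_ 0 j)] := dw s sd sI; rewrite -ball_normE /= distrC.
Qed.

Lemma C1xu_comp_near (R : realType) (n : nat) (q : 'rV[R]_n -> R -> R)
  (a b t : R) (x : R -> 'rV[R]_n) (u : R -> R) :
  C1xu q -> x s @[s --> within `[a, b] (nbhs t)] --> x t ->
  u s @[s --> within `[a, b] (nbhs t)] --> u t ->
  forall e, 0 < e -> exists2 d, 0 < d & forall s, a <= s <= b ->
    `|s - t| < d -> `|q (x s) (u s) - q (x t) (u t)| < e.
Proof.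
move=> Cq xt ut e e0; have [r r0 rq] := C1xu_near (x t) (u t) Cq e0.
have [d1 d10 d1x] := rV_cvg_within_near xt r0.
have [d2 d20 d2u] := cvg_within_near ut r0.
exists (Num.min d1 d2); first by rewrite lt_min d10.
by move=> s sab; rewrite lt_min => /andP[s1 s2]; apply: rq; auto.
Qed.

Lemma sum_ord_split (R : nmodType) (cs ch : nat) (G1 : 'I_cs -> R) (G2 : 'I_ch -> R) :
  \sum_(i < cs) G1 i + \sum_(i < ch) G2 i =
  \sum_(i < cs + ch) match fintype.split i with inl k => G1 k | inr k => G2 k end.
Proof.
rewrite big_split_ord /=; congr (_ + _); apply: eq_bigr => i _.
  by rewrite (unsplitK (inl i)).
by rewrite (unsplitK (inr i)).
Qed.

(** * Maximality of the control and the bang-ride property for the diagonal system *)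

Theorem theorem3 (R : realType) (n cs ch cz : nat) (a : 'I_n -> R)
  (s : 'I_cs -> 'rV[R]_n -> R -> R) (h : 'I_ch -> 'rV[R]_n -> R)
  (z : 'I_cz -> 'rV[R]_n -> R) (phi l : 'rV[R]_n -> R) (tf_free : bool)
  (x0 : 'rV[R]_n) (tf : R) (xs : R -> 'rV[R]_n) (us : R -> R)
  (* multipliers of hypothesis (P) *)
  (l0 : R) (lam : R -> 'rV[R]_n) (mu : R -> 'rV[R]_cs) (nu : R -> 'rV[R]_ch)
  (alpha : 'rV[R]_cz) (gamma : 'rV[R]_ch) (eta : R -> 'rV[R]_ch) :
  let f := fdiag a in
  let g := @gone R n in
  let F := Fsys f g in
  let lamf := (lim (lam t @[t --> tf^'-])) in
  (0 < n)%N ->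
  (* the pair (xs, us) is optimal for (OC) *)
  optimal F s h z phi l tf_free x0 tf xs us ->
  (* the input bounds are components of s *)
  (exists (umin umax : R) (i1 i2 : 'I_cs),
      (forall x u, s i1 x u = umin - u) /\ (forall x u, s i2 x u = u - umax)) ->
  (* no contact times *)
  (forall t, 0 < t < tf -> ~ contact_time h xs t) ->
  (* Assumption 1 (a) *)
  (forall k : 'I_n, C1x (fun x => f x 0 k)) ->
  (forall k : 'I_n, C1x (fun x => g x 0 k)) ->
  C1x phi -> C1x l -> (forall i, C1xu (s i)) -> (forall i, C1x (z i)) ->
  (forall i, C2x (h i)) ->
  (* Assumption 1 (b) *)
  ae_on `[0, tf] (fun t => \rank (A1mat F s h (xs t) (us t)) = (cs + ch)%N) ->
  (* Assumption 4 (a) *)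
  (forall x, l x = 0) ->
  \rank (A4mat phi z (xs tf)) = cz.+1 ->
  (* Assumption 5 *)
  assumption5 h tf xs us ->
  (* Hypothesis (P) *)
  l0 <= 0 ->
  pw_abs_cont tf lam -> pw_cont tf mu -> pw_cont tf nu ->
  (* (P)(i) *)
  (forall t, 0 <= t <= tf ->
     l0 != 0 \/ lam t != 0 \/ mu t != 0 \/ nu t != 0 \/ alpha != 0 \/
     gamma != 0 \/
     (exists tau, 0 < tau < tf /\ ~ {for tau, continuous lam} /\ eta tau != 0)) ->
  (* (P)(ii) *)
  ae_on `[0, tf] (fun t =>
     ((exists u1, Dset F s h (xs t) u1 /\
                  Ham F l (xs t) u1 l0 (lam t) = Ham F l (xs t) (us t) l0 (lam t)) /\
      (forall v, Dset F s h (xs t) v ->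
                 Ham F l (xs t) v l0 (lam t) <= Ham F l (xs t) (us t) l0 (lam t))) /\
     (\sum_(k < n) lam t 0 k * g (xs t) 0 k
      + \sum_(i < cs) mu t 0 i * du (s i (xs t)) (us t)
      + \sum_(i < ch) nu t 0 i * du (hdot F (h i) (xs t)) (us t) = 0) /\
     is_derive t (1 : R) lam
       (\row_j (- (l0 * pd l j (xs t))
                - \sum_(k < n) lam t 0 k * pd (fun y => F y (us t) 0 k) j (xs t)
                - \sum_(i < cs) mu t 0 i * pd (fun y => s i y (us t)) j (xs t)
                - \sum_(i < ch) nu t 0 i * pd (fun y => hdot F (h i) y (us t)) j (xs t))) /\
     (forall i, mu t 0 i <= 0) /\
     \sum_(i < cs) mu t 0 i * s i (xs t) (us t) = 0 /\
     (forall i, nu t 0 i <= 0) /\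
     \sum_(i < ch) nu t 0 i * h i (xs t) = 0) ->
  (* (P)(iii) *)
  lamf = l0 *: grad phi (xs tf) + \sum_(i < cz) alpha 0 i *: grad (z i) (xs tf)
         + \sum_(i < ch) gamma 0 i *: grad (h i) (xs tf) ->
  (forall i, 0 <= alpha 0 i) -> (forall i, gamma 0 i <= 0) ->
  \sum_(i < cz) alpha 0 i * z i (xs tf) = 0 ->
  \sum_(i < ch) gamma 0 i * h i (xs tf) = 0 ->
  (* (P)(iv) *)
  (forall tau, 0 < tau < tf -> ~ {for tau, continuous lam} ->
     entry_time h xs tau /\
     lim (lam t @[t --> tau^'-]) =
       lim (lam t @[t --> tau^'+]) + \sum_(i < ch) eta tau 0 i *: grad (h i) (xs tau) /\
     (forall i, eta tau 0 i <= 0) /\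
     \sum_(i < ch) eta tau 0 i * h i (xs tau) = 0) ->
  (* (P)(v) *)
  (tf_free -> forall t, 0 <= t <= tf -> Ham F l (xs t) (us t) l0 (lam t) = 0) ->
  (* Fact (F) *)
  {within `[0, tf], continuous lam} ->
  (forall tau, 0 < tau < tf -> ~ {for tau, continuous lam} -> eta tau = 0) ->
  gamma = 0 ->
  (* hypotheses (a), (b), (c) of the theorem *)
  (exists j1 j2 : 'I_n, lamf 0 j2 < lamf 0 j1 /\ a j2 < a j1) ->
  (forall k j : 'I_n, lamf 0 j <= lamf 0 k -> a j <= a k) ->
  (forall i : 'I_(cs + ch),
     (exists a0 b0, 0 <= a0 /\ a0 < b0 /\ b0 <= tf /\
        forall t, a0 < t < b0 -> cval s h i (xs t) (us t) = 0) ->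
     ae_on [set t | 0 <= t <= tf /\ cval s h i (xs t) (us t) = 0] (fun t =>
       0 < du (sbar F s h i (xs t)) (us t) /\
       forall k j : 'I_n, lamf 0 j <= lamf 0 k ->
         psens F s h i k (xs t) (us t) <= psens F s h i j (xs t) (us t))) ->
  (* conclusion *)
  ae_on `[0, tf] (fun t =>
     0 < \sum_(k < n) lam t 0 k * g (xs t) 0 k /\
     is_max_of (Dset F s h (xs t)) (us t)) /\
  bang_ride s h tf xs us.
Proof.
move=> f g F lamf n0 [[tf0 [adm [sol [feas _]]]] _] _ _ _ _ _ _ Cs _ Ch _ l0E
  _ _ _ lam_ac mu_pw nu_pw _ necessary _ _ _ _ _ _ _ lam_cont _ _
  [j1 [j2 [_ a21]]] lamf_a sens.
have lamfE : lamf = lam tf.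
  apply: cvg_lim => //.
  by have [_ _] := (continuous_within_itvP lam tf0).1 lam_cont.
rewrite lamfE in lamf_a sens; clear lamf lamfE.
have xs_cont t : 0 <= t <= tf -> xs s @[s --> within `[0, tf] (nbhs t)] --> xs t.
  move=> tI; have [_ [/subspace_continuousP H _]] := sol.
  by apply: H; rewrite /= in_itv.
(* [mu] and [nu] are merged into one family indexed like [sbar]. *)
pose m t (i : 'I_(cs + ch)) :=
  match fintype.split i with inl k => mu t 0 k | inr k => nu t 0 k end.
pose E i t := cval s h i (xs t) (us t).
pose S := sbar F s h.
have E_le0 i t : 0 <= t <= tf -> E i t <= 0.
  move=> tI; have [s0 h0] := feas t tI.
  by rewrite /E /cval; case: fintype.split.
have [Du [_ [us_cont _]]] := adm.
have [Dm [_ [mu_cont _]]] := mu_pw.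
have [Dn [_ [nu_cont _]]] := nu_pw.
(* The endpoints join the discontinuities, so that a time outside [D] is interior. *)
pose D := [:: 0, tf & Du ++ Dm ++ Dn].
have D_cat t : t \notin D -> [/\ t != 0, t != tf, t \notin Du, t \notin Dm & t \notin Dn].
  by rewrite !inE !mem_cat !negb_or => /and5P.
have E_cont i t : 0 <= t <= tf -> t \notin D -> forall e, 0 < e ->
    exists2 d, 0 < d & forall s, 0 <= s <= tf -> `|s - t| < d ->
      `|E i s - E i t| < e.
  move=> tI /D_cat[_ _ tDu _ _].
  apply: (@C1xu_comp_near _ _ (cval s h i)); last 2 first.
  - exact: xs_cont.
  - exact: us_cont.
  rewrite /cval; case: fintype.split => k; first exact: Cs.
  by apply: C1x_C1xu; case: (Ch k).
have m_cont i t : 0 <= t <= tf -> t \notin D -> forall e, 0 < e ->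
    exists2 d, 0 < d & forall s, 0 <= s <= tf -> `|s - t| < d ->
      `|m s i - m t i| < e.
  move=> tI /D_cat[_ _ _ tDm tDn] e e0; rewrite /m; case: fintype.split => k.
    have [d d0 dP] := rV_cvg_within_near (mu_cont t tI tDm) e0.
    by exists d => // s' s'I st; apply: dP.
  have [d d0 dP] := rV_cvg_within_near (nu_cont t tI tDn) e0.
  by exists d => // s' s'I st; apply: dP.
(* Each product of a multiplier and its constraint value is nonnegative, so the zero sums give
   complementarity index by index. *)
have slack : ae_on `[0, tf] (fun t => forall i, m t i <= 0 /\ m t i * E i t = 0).
  apply: ae_on_impl necessary => t H At.
  have [_ [_ [_ [mu0 [mus [nu0 nuh]]]]]] := H At.
  have tI : 0 <= t <= tf by move: At; rewrite /= in_itv.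
  have m0 i : m t i <= 0 by rewrite /m; case: fintype.split.
  move=> i; split; first exact: m0.
  have : \sum_i m t i * E i t = 0.
    have := congr2 +%R mus nuh; rewrite sum_ord_split addr0 => ms.
    rewrite -[RHS]ms; apply: eq_bigr => k _.
    by rewrite /m /E /cval; case: fintype.split.
  by move/psumr_eq0P; apply => // k _; rewrite mulr_le0 ?E_le0.
(* A constraint active on some interval falls under the sensitivity hypothesis; for any other, the
   multiplier vanishes outside [D]. *)
have active : ae_on `[0, tf] (fun t => forall i, m t i != 0 ->
    0 < du (S i (xs t)) (us t) /\ forall k j : 'I_n, lam tf 0 j <= lam tf 0 k ->
      psens F s h i k (xs t) (us t) <= psens F s h i j (xs t) (us t)).
  apply: ae_on_forall => i.
  have notD : ae_on `[0, tf] (fun t => ~ [set` D] t).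
    by apply: ae_on_notin_countable; apply: finite_set_countable; exact: finite_seq.
  have slack_i : ae_on `[0, tf] (fun t => m t i * E i t = 0).
    by apply: ae_on_impl slack => t H /H /(_ i)[].
  have [act|nact] := pselect (exists a0 b0, 0 <= a0 /\ a0 < b0 /\ b0 <= tf /\
      forall t, a0 < t < b0 -> cval s h i (xs t) (us t) = 0).
    apply: ae_on_impl2 slack_i (sens i act) => t mE H At mt; apply: H.
    split; first by move: At; rewrite /= in_itv.
    by apply/eqP; have /eqP := mE At; rewrite mulf_eq0 (negPf mt).
  apply: ae_on_impl notD => t tD At mt; exfalso; apply: nact.
  have tI : 0 <= t <= tf by move: At; rewrite /= in_itv.
  have tD' : t \notin D by apply/negP; exact: tD.
  apply: (@active_near_nonzero_multiplier _ tf t (m ^~ i) (E i) D) => //.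
  - exact: E_cont.
  - exact: m_cont.
  - have [tn0 tntf _ _ _] := D_cat t tD'; move/andP: tI => [t0 ttf].
    by rewrite !lt_neqAle eq_sym tn0 t0 tntf ttf.
pose q t j := - \sum_i m t i * pd (fun y => S i y (us t)) j (xs t).
have g1 t : \sum_(k < n) lam t 0 k * g (xs t) 0 k = \sum_k lam t 0 k.
  by apply: eq_bigr => k _; rewrite mxE mulr1.
have stat : ae_on `[0, tf] (fun t => \sum_k lam t 0 k +
    \sum_i m t i * du (S i (xs t)) (us t) = 0).
  apply: ae_on_impl necessary => t H At; have [_ [+ _]] := H At.
  rewrite g1 -addrA sum_ord_split => st; rewrite -[RHS]st; congr (_ + _).
  apply: eq_bigr => i _.
  by rewrite /m /S /sbar; case: fintype.split.
have ode : ae_on `[0, tf] (fun t => [/\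
    forall j, is_derive t (1 : R) (fun s => lam s 0 j) (- a j * lam t 0 j + q t j),
    0 <= \sum_k lam t 0 k,
    forall k j, lam tf 0 j <= lam tf 0 k -> q t k <= q t j &
    \sum_k lam t 0 k = 0 -> forall j, q t j = 0]).
  have := ae_on_and active slack.
  move=> /(ae_on_and stat).
  apply: ae_on_impl2 necessary => t H1 H2 At.
  have [_ [_ [dlam _]]] := H1 At.
  have [st [act sl]] := H2 At.
  have m0 i : m t i <= 0 by case: (sl i).
  split.
  - move=> j; have dj := is_derive_coord j dlam; rewrite mxE in dj.
    apply: (is_derive_eq dj); rewrite /q.
    have -> : pd l j (xs t) = 0.
      by apply: derive_affine => k; rewrite !l0E mulr0 addr0.
    have -> : \sum_(k < n) lam t 0 k * pd (fun y => F y (us t) 0 k) j (xs t) =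
        a j * lam t 0 j.
      rewrite (bigD1 j)//= pd_diag eqxx mulr1 big1 ?addr0 1?mulrC// => k kj.
      by rewrite pd_diag (negPf kj) !mulr0.
    rewrite mulr0 oppr0 add0r -addrA -opprD sum_ord_split mulNr; congr (_ - _).
    by apply: eq_bigr => i _; rewrite /m /S /sbar; case: fintype.split.
  - exact: (stationary_ge0 m0 act st).
  - move=> k j jk.
    exact: (@stationary_mono _ _ _ _ _ _ (fun j k => lam tf 0 j <= lam tf 0 k) m0 act).
  - move=> s0 j; rewrite /q big1 ?oppr0// => i _.
    by rewrite (stationary_multiplier_eq0 m0 act st s0) mul0r.
(* [j1] only seeds the search for a maximizer of [a]; [j2] then lies strictly below the maximum. *)
have [T _ aT] := @arg_maxP _ _ _ j1 xpredT a isT.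
have sum_gt0 : ae_on `[0, tf] (fun t => 0 < \sum_k lam t 0 k).
  apply: (@costate_sum_gt0 _ _ _ a _ q tf0 lam_ac lam_cont lamf_a ode T _ j2).
    by move=> j; exact: aT.
  by apply: (lt_le_trans a21); exact: aT.
split.
  apply: ae_on_impl2 necessary sum_gt0 => t H1 H2 At.
  have [[[u1 [Du1 Hu1]] Hmax] _] := H1 At; have s0 := H2 At.
  rewrite g1; split=> //.
  (* The Hamiltonian is affine in the input with slope the costate sum, so a maximizer [u1] in the
     control set must coincide with [us t]. *)
  have HamB v w : Ham F l (xs t) v l0 (lam t) - Ham F l (xs t) w l0 (lam t) =
      (v - w) * \sum_k lam t 0 k.
    rewrite /Ham opprD addrACA subrr add0r -sumrB mulr_sumr.
    by apply: eq_bigr => k _; rewrite /F /Fsys /f /g /fdiag /gone !mxE /=; ring.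
  split.
    have /eqP : (u1 - us t) * \sum_k lam t 0 k = 0 by rewrite -HamB Hu1 subrr.
    by rewrite mulf_eq0 (gt_eqF s0) orbF subr_eq0 => /eqP <-.
  by move=> v /Hmax; rewrite -subr_le0 HamB pmulr_lle0// subr_le0.
have := ae_on_and stat slack.
apply: ae_on_impl2 sum_gt0 => t H1 H2 At.
have s0 := H1 At; have [st sl] := H2 At.
(* If every multiplier vanished, stationarity would make the costate sum zero. *)
have [i mi] : exists i, m t i != 0.
  apply: contrapT => /forallNP m0; move: st; rewrite [X in _ + X]big1 ?addr0 => [ss|i _].
    by move: s0; rewrite ss ltxx.
  by have /negP := m0 i; rewrite negbK => /eqP ->; rewrite mul0r.
have [_ /eqP] := sl i; rewrite mulf_eq0 (negPf mi) /= => /eqP.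
rewrite /E /cval; case: fintype.split => k kE; [left|right]; by exists k.
Qed.
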